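(* For any Turing machine $\mathcal{M}$ there is a function $\mathrm{realstep}_{\mathcal{M}}\in\mathrm{AP}$ (taking arguments $(\bar c,\mu)\in\mathbb{R}^4\times\mathbb{R}_+$ and values in $\mathbb{R}^4$) such that for every configuration $c$ of $\mathcal{M}$, every $\mu\in\mathbb{R}_+$ and every $\bar c\in\mathbb{R}^4$: if $\|\langle c\rangle-\bar c\|_\infty\le\frac{1}{2k^2}-e^{-\mu}$ then \[\big\|\mathrm{realstep}_{\mathcal{M}}(\bar c,\mu)-\langle \mathcal{M}(c)\rangle\big\|_\infty\le k\,\|\langle c\rangle-\bar c\|_\infty,\] where $\mathcal{M}(c)$ is the configuration following $c$.
   Context: Fix $k\ge2$ and $\Gamma=\{0,\dots,k-2\}$. A Turing machine $\mathcal{M}=(Q,\Sigma,b,\delta,q_0,q_\infty)$ has tape alphabet $\Sigma\subseteq\Gamma$ (symbols viewed as digits) and states $Q$ identified with numbers. A configuration is a tuple $c=(x,\sigma,y,q)$ where $x\in\Sigma^*$ is the tape content to the left of the head, $y\in\Sigma^*$ the content to the right, $\sigma\in\Sigma$ the symbol under the head and $q\in Q$ the current state; $\mathcal{M}(c)$ denotes the next configuration. The encoding is $\langle c\rangle=(0.x,\sigma,0.y,q)\in\mathbb{Q}\times\Sigma\times\mathbb{Q}\times Q\subseteq\mathbb{R}^4$, where for $x=x_1\cdots x_{|x|}$, $0.x=x_1k^{-1}+x_2k^{-2}+\cdots+x_{|x|}k^{-|x|}$ (and similarly for $0.y$). $\mathbb{R}_+=[0,+\infty[$; $\|\cdot\|_\infty$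 is the sup norm; $\mathrm{len}_y(0,t)=\int_0^t\|y'(s)\|_\infty ds$. $\mathbb{K}$ is a fixed ''generable field'' of real coefficients (one may take $\mathbb{K}=\mathbb{R}_P$). Class $\mathrm{AP}$: $f:\subseteq\mathbb{R}^n\to\mathbb{R}^m$ is in $\mathrm{AP}$ iff there exist $d\ge m$, a vector $p$ of $d$ polynomials in $d$ variables and a vector $q$ of $d$ polynomials in $n$ variables, all with coefficients in $\mathbb{K}$, and a bivariate polynomial $\Omega$, such that for every $x\in\operatorname{dom} f$ there exists a (unique) $y:\mathbb{R}_+\to\mathbb{R}^d$ with, for all $t\in\mathbb{R}_+$: $y(0)=q(x)$ and $y'(t)=p(y(t))$; for all $\mu\in\mathbb{R}_+$, if $\mathrm{len}_y(0,t)\ge\Omega(\|x\|_\infty,\mu)$ then $\|y_{1..m}(t)-f(x)\|_\infty\le e^{-\mu}$; and $\mathrm{len}_y(0,t)\ge t$.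
   Formalization: The formal statement assumes that if the digit 0 belongs to the tape alphabet Σ then it is the blank b; otherwise the empty word and the word 0 have the same encoding but are read differently, and the claim fails for every machine whose head moves. *)

(* Defs.v *)
From HB Require Import structures.
From mathcomp Require Import all_boot all_order all_algebra.
From mathcomp Require Import all_classical all_reals all_analysis.
(* Not imported: its notations clash with those of MathComp-Analysis. *)
From mathcomp Require mpoly.

Set Implicit Arguments.
Unset Strict Implicit.
Unset Printing Implicit Defensive.

Import Order.TTheory GRing.Theory Num.Theory.
Import numFieldNormedType.Exports.

Local Open Scope classical_set_scope.
Local Open Scope ring_scope.

(* ['rV[R]_n] stands for R^n; its library norm [`|_|] is the sup norm. *)

Section PolynomialMaps.
Variable R : realType.

Definition mpoly_map (n d : nat) (p : 'I_d -> mpoly.mpoly n R)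
    (x : 'rV[R]_n) : 'rV[R]_d :=
  \row_i mpoly.meval (fun j => x 0 j) (p i).

Definition coeffs_in (K : {pred R}) (n d : nat)
    (p : 'I_d -> mpoly.mpoly n R) : Prop :=
  forall i, p i \is a mpoly.mpolyOver n K.

End PolynomialMaps.

Section GenerableField.
Variable R : realType.

(* Polynomially bounded generable functions R -> R over K: first components
   of solutions on R of polynomial initial value problems with data in K. *)
Definition GPVAL (K : {pred R}) (f : R -> R) : Prop :=
  exists (n : nat) (p : 'I_n.+1 -> mpoly.mpoly n.+1 R) (t0 : R)
         (y : R -> 'rV[R]_n.+1) (B : {poly R}),
    [/\ coeffs_in K p,
        t0 \in K /\ (forall i, y t0 0 i \in K),
        forall t : R, is_derive t 1 y (mpoly_map p (y t)),
        forall t : R, `|y t| <= B.[`|t|]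
      & forall t : R, f t = y t 0 0].

(* [Q \subset K] follows from [divring_closed K] in characteristic 0. *)
Definition generable_field (K : {pred R}) : Prop :=
  GRing.divring_closed K /\
  (forall (f : R -> R) (a : R), GPVAL K f -> a \in K -> f a \in K).

End GenerableField.

Section ClassAP.
Variable R : realType.

(* y' = p(y) on [0, +oo[, with the right derivative at 0. A function on
   [0, +oo[ is represented by a function on R whose negative part is ignored. *)
Definition solves_on_Rplus (d : nat) (p : 'I_d -> mpoly.mpoly d R)
    (y : R -> 'rV[R]_d) : Prop :=
  (forall t : R, 0 < t -> is_derive t 1 y (mpoly_map p (y t))) /\
  h^-1 *: (y h - y 0) @[h --> 0^'+] --> mpoly_map p (y 0).

(* len_y(0,t). The two-sided derivative [derive1] may be junk at 0, a null set. *)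
Definition curve_len (d : nat) (y : R -> 'rV[R]_d) (t : R) : \bar R :=
  (\int[lebesgue_measure]_(s in `[0%R, t]) (`|derive1 y s|)%:E)%E.

Definition first_coords (m d : nat) (le_md : (m <= d)%N) (v : 'rV[R]_d) :
    'rV[R]_m :=
  \row_(i < m) v 0 (widen_ord le_md i).

Definition AP_computes (n m d : nat) (le_md : (m <= d)%N)
    (p : 'I_d -> mpoly.mpoly d R) (q : 'I_d -> mpoly.mpoly n R)
    (Omega : mpoly.mpoly 2 R) (x : 'rV[R]_n) (fx : 'rV[R]_m)
    (y : R -> 'rV[R]_d) : Prop :=
  [/\ y 0 = mpoly_map q x,
      solves_on_Rplus p y,
      forall t mu : R, 0 <= t -> 0 <= mu ->
        ((mpoly.meval (tnth [tuple `|x|; mu]) Omega)%:E <= curve_len y t)%E ->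
        `|first_coords le_md (y t) - fx| <= expR (- mu)
    & forall t : R, 0 <= t -> (t%:E <= curve_len y t)%E].

(* The partial function is the restriction of f to its domain D. *)
Definition AP (K : {pred R}) (n m : nat) (D : set 'rV[R]_n)
    (f : 'rV[R]_n -> 'rV[R]_m) : Prop :=
  exists (d : nat) (le_md : (m <= d)%N) (p : 'I_d -> mpoly.mpoly d R)
         (q : 'I_d -> mpoly.mpoly n R) (Omega : mpoly.mpoly 2 R),
    [/\ coeffs_in K p,
        coeffs_in K q
      & forall x, D x ->
        exists y : R -> 'rV[R]_d,
          AP_computes le_md p q Omega x (f x) y /\
          (forall z : R -> 'rV[R]_d,
             AP_computes le_md p q Omega x (f x) z ->
             forall t : R, 0 <= t -> z t = y t)].

End ClassAP.

Section TuringMachines.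

Variant move := MoveL | Stay | MoveR.

(* ['I_k.-1] is the set {0, ..., k-2} of digits; states are 0, ..., nstates-1.
   [blank_digit0]: if the digit 0 is a tape symbol, it is the blank. Without
   this the encoding is not well behaved: it does not distinguish the empty
   word (read as blanks) from the word 0, so that two configurations with the
   same encoding could have successors with different encodings. *)
Record turing_machine (k : nat) := TuringMachine {
  nstates : nat;
  alphabet : {set 'I_k.-1};
  blank : {s : 'I_k.-1 | s \in alphabet};
  delta : 'I_nstates -> {s : 'I_k.-1 | s \in alphabet} ->
          'I_nstates * {s : 'I_k.-1 | s \in alphabet} * move;
  init_state : 'I_nstates;
  halt_state : 'I_nstates;
  blank_digit0 : forall s : {s : 'I_k.-1 | s \in alphabet},
    val (val s) = 0%N -> s = blank }.

Definition symbol (k : nat) (M : turing_machine k) :=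
  {s : 'I_k.-1 | s \in alphabet M}.

(* Both words are read outwards: their first letters are adjacent to the
   head. *)
Record config (k : nat) (M : turing_machine k) := Config {
  tape_left : seq (symbol M);
  head_symbol : symbol M;
  tape_right : seq (symbol M);
  state : 'I_(nstates M) }.

Definition next_config (k : nat) (M : turing_machine k) (c : config M) :
    config M :=
  let: Config x s y q := c in
  let: (q', s', mv) := delta q s in
  match mv with
  | MoveL => Config (behead x) (head (blank M) x) (s' :: y) q'
  | Stay  => Config x s' y q'
  | MoveR => Config (s' :: x) (head (blank M) y) (behead y) q'
  end.

Definition digit (k : nat) (M : turing_machine k) (s : symbol M) : nat :=
  val (val s).

(* 0.w = w_1 k^-1 + ... + w_|w| k^-|w|; the list w is indexed from 0. *)
Definition word_val (R : realType) (k : nat) (M : turing_machine k)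
    (w : seq (symbol M)) : R :=
  \sum_(i < size w) (digit (nth (blank M) w i))%:R * k%:R ^- i.+1.

Definition encode (R : realType) (k : nat) (M : turing_machine k)
    (c : config M) : 'rV[R]_4 :=
  \row_i tnth [tuple word_val R (tape_left c);
                     (digit (head_symbol c))%:R;
                     word_val R (tape_right c);
                     (state c)%:R] i.

End TuringMachines.

(* Main.v *)
Require Import Defs.
From HB Require Import structures.
From mathcomp Require Import all_boot all_order all_algebra.
From mathcomp Require Import all_classical all_reals all_analysis.
From mathcomp Require Import measurable_realfun ring lra zify.
From mathcomp Require mpoly.
(* Without the canonical structures of [mpoly], polynomials would have no ring
   operations; its notations clash with those of MathComp-Analysis. *)
Import (canonicals) mpoly.

(* The encoding of the next configuration is polynomial in the input and in
   exact digit tests, so the point is to round exactly within AP. A sharp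
   comparison [l > 0], correct as soon as [|l| >= exp (- mu)], is obtained in
   two stages. The flow [v' = v - v^3] started at [v 0 = l] and run for the
   finite time [mu] yields [|v| >= 1 / 2] with the sign of [l]; the change of
   time [mu (1 - exp (- t))] turns this value into a limit with exponential rate.
   The clamp [(|2 v + 1| - |2 v - 1|) / 4 + 1 / 2] is then exactly 0 or 1.
   The absolute values are limits of [w = sqrt (z^2 + 3 exp (- 2 t))]; since
   [z' = exp (- t) P], the triple [w], [z / w], [exp (- t) / w] solves a
   polynomial system all of whose components stay bounded, so the length of the
   curve grows linearly in time, at a rate polynomial in the input.
   The comparisons are applied to [k * 0.x + 1 / (2 k)], whose integer part is
   the first letter of [x], and to the symbol and the state shifted by [1 / 2].
   All solutions are explicit and all coefficients rational. *)

Set Implicit Arguments.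
Unset Strict Implicit.
Unset Printing Implicit Defensive.

Import Order.TTheory GRing.Theory Num.Theory.
Import numFieldNormedType.Exports.

Local Open Scope classical_set_scope.
Local Open Scope ring_scope.

(** * Differentiation rules for scalar functions *)

Section ScalarDerivatives.
Variable R : realType.
Implicit Types (f g : R -> R) (t a b : R).

Lemma is_derive_add f g t a b : is_derive t 1 f a -> is_derive t 1 g b ->
  is_derive t 1 (fun s => f s + g s) (a + b).
Proof. by move=> df dg; have := is_deriveD df dg; exact. Qed.

Lemma is_derive_sub f g t a b : is_derive t 1 f a -> is_derive t 1 g b ->
  is_derive t 1 (fun s => f s - g s) (a - b).
Proof. by move=> df dg; have := is_deriveB df dg; exact. Qed.

Lemma is_derive_mul f g t a b : is_derive t 1 f a -> is_derive t 1 g b ->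
  is_derive t 1 (fun s => f s * g s) (a * g t + f t * b).
Proof.
move=> df dg; have dM := is_deriveM df dg.
by apply: (is_derive_eq dM); rewrite /GRing.scale/= addrC (mulrC a).
Qed.

Lemma is_derive_const (c t : R) : is_derive t 1 (fun _ : R => c) 0.
Proof. exact: is_derive_cst. Qed.

Lemma is_derive_expR_comp f t a : is_derive t 1 f a ->
  is_derive t 1 (fun s => expR (f s)) (expR (f t) * a).
Proof. by move=> df; exact: is_derive1_comp (is_derive_expR _) df. Qed.

Lemma is_derive_sqrt_comp g t b : 0 < g t -> is_derive t 1 g b ->
  is_derive t 1 (fun s => Num.sqrt (g s)) ((2 * Num.sqrt (g t))^-1 * b).
Proof. by move=> g0 dg; exact: is_derive1_comp (is_derive1_sqrt g0) dg. Qed.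

(** The factor [1 / sqrt (g t)] is pulled out and what remains contains no other root, so that
    quotients by the same root reappear in the derivative and polynomial systems can close up. *)
Lemma is_derive_div_sqrt f g t a b : 0 < g t ->
  is_derive t 1 f a -> is_derive t 1 g b ->
  is_derive t 1 (fun s => f s / Num.sqrt (g s))
    ((a - f t * b / (2 * g t)) / Num.sqrt (g t)).
Proof.
move=> g0 df dg.
have s0 : 0 < Num.sqrt (g t) by rewrite sqrtr_gt0.
have ds := is_derive_sqrt_comp g0 dg.
have dV : is_derive t 1 (fun s => (Num.sqrt (g s))^-1)
    (- (Num.sqrt (g t)) ^- 2 * ((2 * Num.sqrt (g t))^-1 * b)).
  by apply: is_deriveV => //; rewrite lt0r_neq0.
apply: (is_derive_eq (is_derive_mul df dV)).
have e : g t = Num.sqrt (g t) ^+ 2 by rewrite sqr_sqrtr// ltW.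
move: s0 e; set r := Num.sqrt (g t) => s0 ->.
by field; rewrite lt0r_neq0.
Qed.

Lemma is_derive_continuous (V : normedModType R) (h : R -> V) t v :
  is_derive t 1 h v -> {for t, continuous h}.
Proof.
move=> dh; apply/differentiable_continuous; rewrite -derivable1_diffP.
exact: ex_derive.
Qed.

End ScalarDerivatives.

(** * Polynomial expressions with rational coefficients *)

Inductive pexpr (T : Type) : Type :=
| PCst of rat
| PVar of T
| PAdd of pexpr T & pexpr T
| PMul of pexpr T & pexpr T.
Arguments PCst {T}.

Section PolynomialExpressions.
Variable R : realType.

Fixpoint peval (T : Type) (y : T -> R) (P : pexpr T) : R :=
  match P with
  | PCst c => ratr c
  | PVar i => y i
  | PAdd P Q => peval y P + peval y Q
  | PMul P Q => peval y P * peval y Q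
  end.

(** The Lie derivative of [P] along the vector field [F], that is, its time derivative along
    solutions of [y' = F (y)]. *)
Fixpoint plie (T : Type) (F : T -> pexpr T) (P : pexpr T) : pexpr T :=
  match P with
  | PCst _ => PCst 0
  | PVar i => F i
  | PAdd P Q => PAdd (plie F P) (plie F Q)
  | PMul P Q => PAdd (PMul (plie F P) Q) (PMul P (plie F Q))
  end.

Lemma eq_peval (T : Type) (y z : T -> R) : y =1 z -> peval y =1 peval z.
Proof.
move=> yz; elim=> //= [P IHP Q IHQ|P IHP Q IHQ]; by rewrite IHP IHQ.
Qed.

Definition psum (T I : Type) (r : seq I) (F : I -> pexpr T) : pexpr T :=
  foldr (fun i P => PAdd (F i) P) (PCst 0) r.

Lemma peval_psum (T I : Type) (y : T -> R) (r : seq I) (F : I -> pexpr T) :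
  peval y (psum r F) = \sum_(i <- r) peval y (F i).
Proof.
elim: r => [|i r IHr] /=; first by rewrite big_nil rmorph0.
by rewrite big_cons IHr.
Qed.

Lemma is_derive_peval (T : Type) (F : T -> pexpr T) (y : R -> T -> R) (t : R) :
  (forall i, is_derive t 1 (fun s => y s i) (peval (y t) (F i))) ->
  forall P, is_derive t 1 (fun s => peval (y s) P) (peval (y t) (plie F P)).
Proof.
move=> dy; elim=> /= [c|i|P dP Q dQ|P dP Q dQ].
- by rewrite rmorph0; exact: is_derive_cst.
- exact: dy.
- exact: is_derive_add.
- exact: is_derive_mul.
Qed.

(** The coefficient map [h] is a parameter so that the same translation can be made over [rat] with
    [id] and over the reals with [ratr]. *)
Fixpoint pexpr_mpoly (S : comNzRingType) (h : rat -> S) (T : Type) (n : nat)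
    (v : T -> 'I_n) (P : pexpr T) : mpoly.mpoly n S :=
  match P with
  | PCst c => mpoly.mpolyC n (h c)
  | PVar i => mpoly.mpolyX S (mpoly.mnm1 (v i))
  | PAdd P Q => pexpr_mpoly h v P + pexpr_mpoly h v Q
  | PMul P Q => pexpr_mpoly h v P * pexpr_mpoly h v Q
  end.

Lemma meval_pexpr_mpoly (T : Type) (n : nat) (v : T -> 'I_n) (x : 'I_n -> R) P :
  mpoly.meval x (pexpr_mpoly ratr v P) = peval (x \o v) P.
Proof.
elim: P => /= [c|i|P IHP Q IHQ|P IHP Q IHQ].
- exact: mpoly.mevalC.
- exact: mpoly.mevalXU.
- by rewrite mpoly.mevalD IHP IHQ.
- by rewrite mpoly.mevalM IHP IHQ.
Qed.

Lemma divring_closed_ratr (K : {pred R}) (c : rat) :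
  GRing.divring_closed K -> ratr c \in K.
Proof.
move=> [K1 KB KV].
have K0 : 0 \in K by rewrite -(subrr 1) KB.
have KN x : x \in K -> - x \in K by move=> xK; rewrite -sub0r KB.
have KD x y : x \in K -> y \in K -> x + y \in K.
  by move=> xK yK; rewrite -[y]opprK; apply: KB => //; exact: KN.
have Knat n : n%:R \in K.
  by elim: n => // n IHn; rewrite mulrSr; exact: KD.
have Kint (z : int) : z%:~R \in K.
  case: z => n; first exact: Knat.
  by rewrite NegzE mulrNz; apply: KN; exact: Knat.
by apply: KV; exact: Kint.
Qed.

(** The real polynomial is the image under [ratr] of the one computed over [rat], so its
    coefficients are rational and lie in [K]. *)
Lemma pexpr_mpolyOver (K : {pred R}) (T : Type) (n : nat) (v : T -> 'I_n) P :
  GRing.divring_closed K -> pexpr_mpoly ratr v P \is a mpoly.mpolyOver n K.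
Proof.
move=> hK.
suff -> : pexpr_mpoly (@ratr R) v P =
    mpoly.map_mpoly ratr (pexpr_mpoly id v P).
  rewrite qualifE /=; apply/allP => _ /mapP[m _ ->].
  rewrite mpoly.mcoeff_map_mpoly inE.
  exact: divring_closed_ratr.
elim: P => /= [c|i|P -> Q ->|P -> Q ->].
- by rewrite mpoly.map_mpolyC.
- by rewrite mpoly.map_mpolyX.
- by rewrite rmorphD.
- by rewrite rmorphM.
Qed.

End PolynomialExpressions.

(** * Sup norm and differentiation of row vectors, coordinate by coordinate *)

Section RowVectors.
Variable R : realType.

Lemma row_norm_le n (v : 'rV[R]_n) (c : R) : 0 <= c ->
  (forall i, `|v 0 i| <= c) -> `|v| <= c.
Proof.
move=> c0 vc; rewrite [leLHS]/Num.Def.normr/= mx_normrE.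
by apply: bigmax_le => // -[i j] _ /=; rewrite ord1.
Qed.

Lemma coord_norm_le n (v : 'rV[R]_n) i : `|v 0 i| <= `|v|.
Proof.
rewrite [leRHS]/Num.Def.normr/= mx_normrE.
exact: (le_bigmax _ (fun ij => `|v ij.1 ij.2|) (0, i)).
Qed.

Lemma coord_normB_le n (v w : 'rV[R]_n) i : `|v 0 i - w 0 i| <= `|v - w|.
Proof. by have := coord_norm_le (v - w) i; rewrite !mxE. Qed.

Lemma is_derive_coord n (y : R -> 'rV[R]_n) (t : R) (v : 'rV[R]_n) i :
  is_derive t 1 y v -> is_derive t 1 (fun s => y s 0 i) (v 0 i).
Proof.
move=> dy; have dy' : derivable y t 1 by exact: ex_derive.
have /derivable_mxP/(_ 0 i) di := dy'.
apply: DeriveDef => //.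
by rewrite -(@derive_val _ _ _ _ _ _ _ dy) derive_mx// mxE.
Qed.

Lemma is_derive_row n (y : R -> 'rV[R]_n) (t : R) (v : 'rV[R]_n) :
  (forall i, is_derive t 1 (fun s => y s 0 i) (v 0 i)) -> is_derive t 1 y v.
Proof.
move=> dy; have dy' : derivable y t 1.
  by apply/derivable_mxP => i j; rewrite ord1; exact: ex_derive.
apply: DeriveDef => //; apply/rowP => i.
by rewrite derive_mx// mxE; exact: derive_val.
Qed.

End RowVectors.

(** * Polynomial maps are Lipschitz on bounded sets *)

Section LipschitzOnBoundedSets.
Variables (R : realType) (n : nat).

(** The constant may depend on the radius [M]; unlike global Lipschitz continuity, this property is
    stable under products. *)
Definition bounded_lipschitz (g : 'rV[R]_n -> R) : Prop :=
  forall M, exists2 L, 0 <= L &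
    forall a b, `|a| <= M -> `|b| <= M -> `|g a - g b| <= L * `|a - b|.

Lemma bounded_lipschitz_cst c : bounded_lipschitz (fun=> c).
Proof. by move=> M; exists 0 => // a b _ _; rewrite subrr normr0 mul0r. Qed.

Lemma bounded_lipschitz_coord i : bounded_lipschitz (fun v => v 0 i).
Proof.
move=> M; exists 1 => // a b _ _; rewrite mul1r; exact: coord_normB_le.
Qed.

Lemma bounded_lipschitzD g h : bounded_lipschitz g -> bounded_lipschitz h ->
  bounded_lipschitz (fun v => g v + h v).
Proof.
move=> lg lh M; have [L L0 gL] := lg M; have [L' L'0 hL] := lh M.
exists (L + L'); first exact: addr_ge0.
move=> a b aM bM; rewrite opprD addrACA mulrDl.
by rewrite (le_trans (ler_normD _ _))// lerD ?gL ?hL.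
Qed.

Lemma bounded_lipschitz_bounded g M : bounded_lipschitz g ->
  exists2 B, 0 <= B & forall a, `|a| <= M -> `|g a| <= B.
Proof.
move=> lg; have [M0|M0] := leP 0 M; last first.
  by exists 0 => // a aM; have := le_lt_trans aM M0; rewrite ltNge normr_ge0.
have [L L0 gL] := lg M; exists (`|g 0| + L * M).
  by rewrite addr_ge0// mulr_ge0.
move=> a aM; rewrite -[g a](subrK (g 0)) addrC.
rewrite (le_trans (ler_normD _ _))// lerD// (le_trans (gL _ _ aM _))//.
  by rewrite normr0.
by rewrite subr0 ler_wpM2l.
Qed.

Lemma bounded_lipschitzM g h : bounded_lipschitz g -> bounded_lipschitz h ->
  bounded_lipschitz (fun v => g v * h v).
Proof.
move=> lg lh M; have [L L0 gL] := lg M; have [L' L'0 hL] := lh M.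
have [B B0 gB] := bounded_lipschitz_bounded M lg.
have [B' B'0 hB] := bounded_lipschitz_bounded M lh.
exists (B * L' + B' * L); first by rewrite addr_ge0// mulr_ge0.
move=> a b aM bM.
have -> : g a * h a - g b * h b = g a * (h a - h b) + h b * (g a - g b) by ring.
rewrite (le_trans (ler_normD _ _))// !normrM mulrDl -!mulrA.
by rewrite lerD// ler_pM// ?gB ?hB ?gL ?hL.
Qed.

Lemma bounded_lipschitz_sum I (r : seq I) (g : I -> 'rV[R]_n -> R) :
  (forall i, bounded_lipschitz (g i)) ->
  bounded_lipschitz (fun v => \sum_(i <- r) g i v).
Proof.
move=> lg; elim: r => [|i r IHr].
  rewrite (_ : (fun _ => _) = fun=> 0); first exact: bounded_lipschitz_cst.
  by apply/funext => v; rewrite big_nil.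
rewrite (_ : (fun _ => _) = fun v => g i v + \sum_(j <- r) g j v).
  exact: bounded_lipschitzD.
by apply/funext => v; rewrite big_cons.
Qed.

Lemma bounded_lipschitz_prod I (r : seq I) (g : I -> 'rV[R]_n -> R) :
  (forall i, bounded_lipschitz (g i)) ->
  bounded_lipschitz (fun v => \prod_(i <- r) g i v).
Proof.
move=> lg; elim: r => [|i r IHr].
  rewrite (_ : (fun _ => _) = fun=> 1); first exact: bounded_lipschitz_cst.
  by apply/funext => v; rewrite big_nil.
rewrite (_ : (fun _ => _) = fun v => g i v * \prod_(j <- r) g j v).
  exact: bounded_lipschitzM.
by apply/funext => v; rewrite big_cons.
Qed.

Lemma bounded_lipschitz_meval (p : mpoly.mpoly n R) :
  bounded_lipschitz (fun v => mpoly.meval (fun j => v 0 j) p).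
Proof.
apply: bounded_lipschitz_sum => m.
apply: bounded_lipschitzM; first exact: bounded_lipschitz_cst.
apply: bounded_lipschitz_prod => i /=.
elim: (_ i) => [|e IHe]; first exact: bounded_lipschitz_cst.
rewrite (_ : (fun _ => _) = fun v : 'rV_n => v 0 i * v 0 i ^+ e).
  by apply: bounded_lipschitzM => //; exact: bounded_lipschitz_coord.
by apply/funext => v; rewrite exprS.
Qed.

Lemma mpoly_map_lipschitz d (p : 'I_d -> mpoly.mpoly n R) (M : R) :
  exists2 L, 0 <= L & forall a b, `|a| <= M -> `|b| <= M ->
    `|mpoly_map p a - mpoly_map p b| <= L * `|a - b|.
Proof.
have /choice[L HL] i : exists L, 0 <= L /\ forall a b, `|a| <= M -> `|b| <= M ->
    `|mpoly_map p a 0 i - mpoly_map p b 0 i| <= L * `|a - b|.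
  have [L L0 pL] := bounded_lipschitz_meval (p i) M.
  by exists L; split=> // a b aM bM; rewrite !mxE; exact: pL.
have L0 : 0 <= \sum_i L i by apply: sumr_ge0 => i _; case: (HL i).
exists (\sum_i L i) => // a b aM bM.
apply: row_norm_le => [|i]; first by rewrite mulr_ge0.
rewrite !mxE; have [_ /(_ a b aM bM)] := HL i; rewrite !mxE => /le_trans; apply.
rewrite ler_wpM2r// (bigD1 i)//= lerDl; apply: sumr_ge0 => j _.
by case: (HL j).
Qed.

End LipschitzOnBoundedSets.

(** * Uniqueness for polynomial initial value problems *)

Section SolutionUniqueness.
Variables (R : realType) (d : nat) (p : 'I_d -> mpoly.mpoly d R).

Lemma is_derive_bigsum n (h : 'I_n -> R -> R) (t : R) (dh : 'I_n -> R) :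
  (forall i, is_derive t 1 (h i) (dh i)) ->
  is_derive t 1 (fun s => \sum_(i < n) h i s) (\sum_(i < n) dh i).
Proof.
move=> dhi; have := is_derive_sum dhi.
by rewrite (_ : \sum_(i < n) h i = fun s => \sum_(i < n) h i s)// fct_sumE.
Qed.

(** At 0 only the right difference quotient is known to converge; multiplying it by [h] and adding
    [y 0] gives right continuity. *)
Lemma solves_coord_continuous y T i : solves_on_Rplus p y -> 0 < T ->
  {within `[0, T], continuous (fun t => y t 0 i)}.
Proof.
move=> [dy dy0] T0; have cy t : 0 < t -> {for t, continuous (fun t => y t 0 i)}.
  by move=> t0; apply: is_derive_continuous; apply: is_derive_coord; exact: dy.
apply/continuous_within_itvP => //; split.
- by move=> t; rewrite in_itv/= => /andP[t0 _]; exact: cy.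
- have dyi : h^-1 * (y h 0 i - y 0 0 i) @[h --> 0^'+] --> mpoly_map p (y 0) 0 i.
    rewrite [X in X @ _ --> _](_ : _ =
      (fun v : 'rV[R]_d => v 0 i) \o (fun h => h^-1 *: (y h - y 0))).
      apply: (cvg_comp _ _ dy0); exact: coord_continuous.
    by apply/funext => h /=; rewrite !mxE.
  have id0 : (h : R) @[h --> (0 : R)^'+] --> (0 : R).
    by apply: cvg_at_right_filter; exact: cvg_id.
  have y0i : h * (h^-1 * (y h 0 i - y 0 0 i)) + y 0 0 i @[h --> (0 : R)^'+] -->
      y 0 0 i.
    rewrite -[X in _ --> X]add0r -[X in _ --> X + _](mul0r (mpoly_map p (y 0) 0 i)).
    by apply: cvgD; [exact: cvgM|exact: cvg_cst].
  apply: cvg_trans; last exact: y0i.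
  apply: near_eq_cvg; near=> h => /=.
  have h0 : h != 0 by rewrite gt_eqF//; near: h; exact: nbhs_right_gt.
  by rewrite mulrA mulfV// mul1r subrK.
- by apply: cvg_at_left_filter; exact: cy.
Unshelve. all: by end_near. Qed.

Lemma solves_bounded y T : solves_on_Rplus p y -> 0 < T ->
  exists2 M, 0 <= M & forall t, 0 <= t <= T -> `|y t| <= M.
Proof.
move=> sy T0; have /choice[B HB] i : exists B, 0 <= B /\
    forall t, 0 <= t <= T -> `|y t 0 i| <= B.
  have cn : {within `[0, T], continuous (fun t => `|y t 0 i|)}.
    by move=> t; apply: cvg_norm; exact: solves_coord_continuous.
  have [c _ ymax] := EVT_max (ltW T0) cn.
  exists `|y c 0 i|; split => // t tT; apply: ymax; by rewrite in_itv/=.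
have B0 : 0 <= \sum_i B i by apply: sumr_ge0 => i _; case: (HB i).
exists (\sum_i B i) => // t tT; apply: row_norm_le => // i.
have [_ /(_ t tT) /le_trans] := HB i; apply.
by rewrite (bigD1 i)//= lerDl; apply: sumr_ge0 => j _; case: (HB j).
Qed.

(* Gronwall's argument: [u = \sum_i (z_i - y_i)^2] satisfies [u' <= C u] and
   [u 0 = 0], so that [u * exp (- C t)] is nonincreasing and nonnegative. *)
Lemma solves_unique y z : solves_on_Rplus p y -> solves_on_Rplus p z ->
  y 0 = z 0 -> forall t, 0 <= t -> z t = y t.
Proof.
move=> sy sz yz0 T; rewrite le_eqVlt => /predU1P[<-//|T0].
have [My My0 yM] := solves_bounded sy T0.
have [Mz Mz0 zM] := solves_bounded sz T0.
(* The radius [My + Mz] bounds both solutions on [[0, T]]. *)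
have [L L0 pL] := mpoly_map_lipschitz p (My + Mz).
pose D s i := z s 0 i - y s 0 i.
pose u s := \sum_i D s i * D s i.
pose C : R := d%:R * 2 * L.
pose dp s i := mpoly_map p (z s) 0 i - mpoly_map p (y s) 0 i.
pose du s := \sum_i (dp s i * D s i + D s i * dp s i).
pose g s := u s * expR (- C * s).
pose dg s := du s * expR (- C * s) + u s * (expR (- C * s) * (- C)).
have u0 s : 0 <= u s by apply: sumr_ge0 => i _; rewrite -expr2 sqr_ge0.
have cD i : {within `[0, T], continuous (D ^~ i)}.
  move=> s; apply: cvgB; exact: solves_coord_continuous.
have cu : {within `[0, T], continuous u}.
  rewrite /u; move=> s.
  apply: cvg_big => [|i _]; first exact: add_continuous.
  by apply: cvgM; exact: cD.
have dexp (s : R) : is_derive s 1 (fun s => expR (- C * s)) (expR (- C * s) * - C).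
  apply: is_derive_expR_comp.
  have := is_derive_mul (is_derive_const (- C) s) (is_derive_id s 1).
  by rewrite mul0r add0r mulr1.
have cg : {within `[0, T], continuous g}.
  move=> s; apply: cvgM; first exact: cu.
  apply: continuous_subspaceT => r; exact: is_derive_continuous (dexp r).
have dD (s : R) i : 0 < s -> is_derive s 1 (D ^~ i) (dp s i).
  move=> s0; apply: is_derive_sub; apply: is_derive_coord.
    by case: sz => + _; exact.
  by case: sy => + _; exact.
have dgP s : s \in `]0, T[ -> is_derive s 1 g (dg s).
  rewrite in_itv/= => /andP[s0 _]; apply: (is_derive_mul _ (dexp s)).
  by apply: is_derive_bigsum => i; apply: is_derive_mul; exact: dD.
(* Each of the [d] summands of [du] is at most [2 L |z - y|^2] in the sup norm, and this squared
   norm is at most [u]; hence the value of [C]. *)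
have duC s : 0 <= s <= T -> du s <= C * u s.
  move=> sT; have sub_u : `|z s - y s| ^+ 2 <= u s.
    rewrite -[leRHS]sqr_sqrtr// ler_sqr ?nnegrE ?sqrtr_ge0//.
    apply: row_norm_le => [|i]; first exact: sqrtr_ge0.
    rewrite !mxE -sqrtr_sqr ler_wsqrtr// expr2 /u (bigD1 i)//= lerDl.
    by apply: sumr_ge0 => j _; rewrite -expr2 sqr_ge0.
  apply: (@le_trans _ _ (\sum_(i < d) 2 * L * `|z s - y s| ^+ 2)).
    apply: ler_sum => i _; rewrite -mulrA.
    have -> : dp s i * D s i + D s i * dp s i = 2 * (dp s i * D s i) by ring.
    rewrite ler_wpM2l// (le_trans (ler_norm _))// normrM expr2 mulrA.
    apply: ler_pM => //.
      apply: (le_trans (coord_normB_le _ _ i)).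
      by apply: pL; [rewrite (le_trans (zM s sT))// lerDr|
                     rewrite (le_trans (yM s sT))// lerDl].
    exact: coord_normB_le.
  by rewrite sumr_const card_ord -[leLHS]mulr_natl /C -!mulrA !ler_wpM2l.
have [c cT gc] := MVT T0 dgP cg.
have g0 : g 0 = 0.
  by rewrite /g /u big1 ?mul0r// => i _; rewrite /D yz0 subrr mul0r.
have cT' : 0 <= c <= T.
  by move: cT; rewrite in_itv/= => /andP[c0 cT]; rewrite !ltW.
have gT : g T <= 0.
  move: gc; rewrite g0 !subr0 => ->; rewrite pmulr_lle0// /dg.
  rewrite [X in _ + X]mulrCA mulrC -mulrDr pmulr_rle0 ?expR_gt0//.
  by rewrite mulrN subr_le0 mulrC duC.
have uT : u T = 0.
  apply/eqP; rewrite eq_le u0 andbT.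
  by move: gT; rewrite /g pmulr_lle0// expR_gt0.
apply/rowP => i; apply/eqP; rewrite -subr_eq0 -sqrf_eq0 expr2.
have /psumr_eq0P/(_ i isT)/eqP := uT; apply=> j _; by rewrite -expr2 sqr_ge0.
Qed.

End SolutionUniqueness.

(** * Bounds on the length of a curve from bounds on its speed *)

Section CurveLength.
Variables (R : realType) (d : nat).

Lemma mpoly_map_continuous e (p : 'I_e -> mpoly.mpoly d R) :
  continuous (mpoly_map p).
Proof.
move=> a; apply/(@cvgrPdist_lt _ _ _ _ (nbhs_filter (a : 'rV[R]_d))) => eps eps0.
have [L L0 pL] := mpoly_map_lipschitz p (`|a| + 1).
(* [L] may vanish, so the radius of the neighbourhood is obtained by dividing by [L + 1]. *)
have L1 : 0 < L + 1 by rewrite ltr_wpDl.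
have near_dist r : 0 < r -> \forall b \near a, `|a - b| < r.
  by move=> r0; exact: (nbhs_ball_norm a (PosNum r0)).
near=> b.
have ab1 : `|a - b| < 1 by near: b; exact: near_dist.
have abe : `|a - b| < eps / (L + 1).
  by near: b; apply: near_dist; rewrite divr_gt0.
apply: (@le_lt_trans _ _ (L * `|a - b|)).
  apply: pL; first by rewrite lerDl.
  rewrite -[b](subKr a) (le_trans (ler_normB _ _))// lerD2l; exact: ltW.
rewrite (@le_lt_trans _ _ ((L + 1) * `|a - b|))//.
  by rewrite ler_wpM2r// lerDl.
by rewrite mulrC -ltr_pdivlMr.
Unshelve. all: by end_near. Qed.

(** The two-sided derivative is assumed at 0 as well, so [derive1 y] agrees with [v] on all of
    [[0, t]] and the integrals of the constants [a] and [b] enclose the length. *)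
Lemma curve_len_bounds (y v : R -> 'rV[R]_d) (a b t : R) : 0 <= t ->
  (forall s : R, 0 <= s -> is_derive s 1 y (v s)) ->
  {within `[0, t], continuous (fun s : R => `|v s|)} ->
  (forall s, 0 <= s -> a <= `|v s| <= b) -> 0 <= a ->
  ((a * t)%:E <= curve_len y t <= (b * t)%:E)%E.
Proof.
move=> t0 dy cv vab a0; rewrite /curve_len.
have -> : (\int[lebesgue_measure]_(s in `[0%R, t]) (`|derive1 y s|)%:E =
    \int[lebesgue_measure]_(s in `[0%R, t]) (`|v s|)%:E)%E.
  apply: eq_integral => s; rewrite inE/= in_itv/= => /andP[s0 _].
  by rewrite derive1E (@derive_val _ _ _ _ _ _ _ (dy s s0)).
have mv : measurable_fun `[0, t] (EFin \o (fun s : R => `|v s| : R)).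
  by apply/measurable_EFinP; apply: subspace_continuous_measurable_fun.
have leb : lebesgue_measure `[0%R, t]%classic = t%:E.
  rewrite lebesgue_measure_itv/= lte_fin.
  by case: ltgtP t0 => // [_ _|<- _]; rewrite ?sube0.
have cst c : (\int[lebesgue_measure]_(s in `[0%R, t]) c%:E = (c * t)%:E)%E.
  by rewrite integral_cst//= leb EFinM.
have in0 s : `[0, t]%classic s -> 0 <= s by rewrite /= in_itv/= => /andP[].
rewrite -!cst; apply/andP; split; apply: ge0_le_integral => //=.
- by move=> s /in0/vab/andP[]; rewrite lee_fin.
- by move=> s /in0/vab/andP[]; rewrite lee_fin.
Qed.

End CurveLength.

(** * Estimates polynomial in the input: boundedness and exponential convergence *)

Section PolynomialBounds.
Variables (R : realType) (n : nat) (D : set 'rV[R]_n).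

(** Powers of [1 + |x|] serve as normal form for polynomial bounds: they increase with the exponent,
    so sums and products of functions are handled by adding exponents. The weight [w] is 1 for
    boundedness and [exp (- t)] for convergence. *)
Definition poly_le (w : R -> R) (f : 'rV[R]_n -> R -> R) : Prop :=
  exists C N, 0 <= C /\ forall x t, D x -> 0 <= t ->
    `|f x t| <= C * (1 + `|x|) ^+ N * w t.

Definition polybounded := poly_le (fun=> 1).

Definition converges_exp (f : 'rV[R]_n -> R -> R) (g : 'rV[R]_n -> R) :=
  poly_le (fun t => expR (- t)) (fun x t => f x t - g x).

Lemma ler_poly_weight (x : 'rV[R]_n) N N' : (N <= N')%N ->
  (1 + `|x|) ^+ N <= (1 + `|x|) ^+ N'.
Proof. by move=> NN'; apply: ler_weXn2l => //; rewrite lerDl. Qed.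

Lemma poly_weight_ge0 (x : 'rV[R]_n) N : 0 <= (1 + `|x|) ^+ N.
Proof. by rewrite exprn_ge0// addr_ge0. Qed.

Lemma poly_leD w f g : (forall t, 0 <= w t) -> poly_le w f -> poly_le w g ->
  poly_le w (fun x t => f x t + g x t).
Proof.
move=> w0 [C [N [C0 fC]]] [C' [N' [C'0 gC]]].
exists (C + C'), (N + N')%N; split; first exact: addr_ge0.
move=> x t Dx t0; rewrite (le_trans (ler_normD _ _))// !mulrDl lerD//.
  rewrite (le_trans (fC x t Dx t0))// ler_wpM2r// ler_wpM2l//.
  by apply: ler_poly_weight; exact: leq_addr.
rewrite (le_trans (gC x t Dx t0))// ler_wpM2r// ler_wpM2l//.
by apply: ler_poly_weight; exact: leq_addl.
Qed.

Lemma poly_leM w w' f g : poly_le w f -> poly_le w' g ->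
  poly_le (fun t => w t * w' t) (fun x t => f x t * g x t).
Proof.
move=> [C [N [C0 fC]]] [C' [N' [C'0 gC]]].
exists (C * C'), (N + N')%N; split; first exact: mulr_ge0.
move=> x t Dx t0; rewrite normrM exprD.
rewrite (_ : _ * _ = (C * (1 + `|x|) ^+ N * w t) *
  (C' * (1 + `|x|) ^+ N' * w' t)); last by ring.
by apply: ler_pM => //; [exact: fC|exact: gC].
Qed.

Lemma poly_leW w f g : poly_le w g ->
  (forall x t, D x -> 0 <= t -> `|f x t| <= `|g x t|) -> poly_le w f.
Proof.
move=> [C [N [C0 gC]]] fg; exists C, N; split => // x t Dx t0.
by rewrite (le_trans (fg x t Dx t0))// gC.
Qed.

Lemma poly_le_uniform (I : finType) w (f : I -> 'rV[R]_n -> R -> R) :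
  (forall t, 0 <= w t) -> (forall i, poly_le w (f i)) ->
  exists C N, 0 <= C /\ forall i x t, D x -> 0 <= t ->
    `|f i x t| <= C * (1 + `|x|) ^+ N * w t.
Proof.
move=> w0 /choice[C /choice[N CN]].
have C0 : forall i, 0 <= C i by move=> i; case: (CN i).
exists (\sum_i C i), (\sum_i N i)%N; split; first exact: sumr_ge0.
move=> i x t Dx t0; have [_ /(_ x t Dx t0)] := CN i.
move=> /le_trans; apply; rewrite ler_wpM2r// ler_pM ?poly_weight_ge0//.
  by rewrite (bigD1 i)//= lerDl sumr_ge0.
by apply: ler_poly_weight; rewrite (bigD1 i)//= leq_addr.
Qed.

Lemma polybounded_cst c : polybounded (fun _ _ => c).
Proof.
by exists `|c|, 0; split => // x t _ _; rewrite expr0 !mulr1.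
Qed.

Lemma polyboundedD f g : polybounded f -> polybounded g ->
  polybounded (fun x t => f x t + g x t).
Proof. by apply: poly_leD => t. Qed.

Lemma polyboundedM f g : polybounded f -> polybounded g ->
  polybounded (fun x t => f x t * g x t).
Proof.
move=> fb gb; have := poly_leM fb gb; rewrite /polybounded.
by rewrite (_ : (fun _ => 1 * 1) = fun=> 1)//; apply/funext => t; rewrite mulr1.
Qed.

Lemma polybounded_norm : polybounded (fun x _ => `|x|).
Proof.
exists 1, 1; split => // x t _ _.
by rewrite mul1r mulr1 expr1 normr_id lerDr.
Qed.

Lemma polybounded_coord i : polybounded (fun x _ => x 0 i).
Proof.
apply: poly_leW polybounded_norm _ => x t _ _.
by rewrite normr_id coord_norm_le.
Qed.

Lemma polybounded_peval (T : Type) (y : 'rV[R]_n -> R -> T -> R) (P : pexpr T) :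
  (forall i, polybounded (fun x t => y x t i)) ->
  polybounded (fun x t => peval (y x t) P).
Proof.
move=> yb; elim: P => /= [c|i|P IHP Q IHQ|P IHP Q IHQ].
- exact: polybounded_cst.
- exact: yb.
- exact: polyboundedD.
- exact: polyboundedM.
Qed.

Lemma converges_exp_cst f : converges_exp (fun x _ => f x) f.
Proof.
by exists 0, 0; split => // x t _ _; rewrite subrr normr0 !mul0r.
Qed.

Lemma converges_expD f g f' g' : converges_exp f f' -> converges_exp g g' ->
  converges_exp (fun x t => f x t + g x t) (fun x => f' x + g' x).
Proof.
move=> ff' gg'; have e0 t : 0 <= expR (- t) :> R by exact: expR_ge0.
apply: poly_leW (poly_leD e0 ff' gg') _ => x t _ _.
by rewrite opprD addrACA.
Qed.

Lemma converges_expZ c f f' : converges_exp f f' ->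
  converges_exp (fun x t => c * f x t) (fun x => c * f' x).
Proof.
move=> [C [N [C0 CN]]]; exists (`|c| * C), N; split; first exact: mulr_ge0.
by move=> x t Dx t0; rewrite -mulrBr normrM -!mulrA ler_wpM2l// mulrA CN.
Qed.

(** Follows from [f g - f' g' = g (f - f') + f' (g - g')]. *)
Lemma converges_expM f g f' g' :
  polybounded (fun x _ => f' x) -> polybounded g ->
  converges_exp f f' -> converges_exp g g' ->
  converges_exp (fun x t => f x t * g x t) (fun x => f' x * g' x).
Proof.
move=> fb gb ff' gg'.
have e (w : R -> R) : (fun t => 1 * w t) = w by apply/funext => t; rewrite mul1r.
have e0 t : 0 <= expR (- t) :> R by exact: expR_ge0.
have := poly_leM gb ff'; have := poly_leM fb gg'; rewrite !e => fgg' gff'.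
apply: poly_leW (poly_leD e0 gff' fgg') _ => x t _ _.
by rewrite le_eqVlt; apply/orP; left; apply/eqP; congr `|_|; ring.
Qed.

(** Compare [f'] with [f] at time 0, where the weight [exp (- t)] is 1. *)
Lemma converges_exp_polybounded f f' : converges_exp f f' ->
  polybounded f -> polybounded (fun x _ => f' x).
Proof.
move=> [C [N [C0 fC]]] fb.
have -> : (fun x _ => f' x) = (fun x (_ : R) => (f' x - f x 0) + f x 0).
  by apply/funext => x; apply/funext => t; rewrite subrK.
have [B [M [B0 fB]]] := fb.
apply: polyboundedD.
  exists C, N; split=> // x t Dx t0.
  have := fC x 0 Dx (lexx _); by rewrite oppr0 expR0 distrC.
by exists B, M; split => // x t Dx t0; have := fB x 0 Dx (lexx _).
Qed.

Lemma converges_exp_peval (T : Type) (y : 'rV[R]_n -> R -> T -> R)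
    (z : 'rV[R]_n -> T -> R) (P : pexpr T) :
  (forall i, polybounded (fun x t => y x t i)) ->
  (forall i, converges_exp (fun x t => y x t i) (fun x => z x i)) ->
  converges_exp (fun x t => peval (y x t) P) (fun x => peval (z x) P).
Proof.
move=> yb yz; elim: P => /= [c|i|P IHP Q IHQ|P IHP Q IHQ].
- exact: (converges_exp_cst (fun=> ratr c)).
- exact: yz.
- exact: converges_expD.
- apply: converges_expM => //; last exact: polybounded_peval.
  by apply: converges_exp_polybounded IHP _; exact: polybounded_peval.
Qed.

End PolynomialBounds.

(** * Substitution, and membership in [AP] from an explicit polynomial system *)

Section Substitution.
Variables (R : realType) (S T : Type).

Fixpoint psubst (h : S -> pexpr T) (P : pexpr S) : pexpr T :=
  match P with
  | PCst c => PCst c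
  | PVar i => h i
  | PAdd P Q => PAdd (psubst h P) (psubst h Q)
  | PMul P Q => PMul (psubst h P) (psubst h Q)
  end.

Lemma peval_psubst (h : S -> pexpr T) (y : T -> R) P :
  peval y (psubst h P) = peval (fun i => peval y (h i)) P.
Proof. by elim: P => //= [P -> Q ->|P -> Q ->]. Qed.

End Substitution.

(* The coordinates of the system are the [m] outputs [G], the variables in [T],
   and a clock [None], which makes the curve at least as long as the time. *)
Section PolynomialSystems.
Variables (R : realType) (K : {pred R}) (n m : nat) (D : set 'rV[R]_n).
Variables (T : finType) (F : T -> pexpr T) (q : T -> pexpr 'I_n).
Variables (G : 'I_m -> pexpr T) (y : 'rV[R]_n -> R -> T -> R).
Variable f : 'rV[R]_n -> 'rV[R]_m.
Hypothesis K_divring : GRing.divring_closed K.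
Hypothesis y_init : forall x, D x -> forall i,
  y x 0 i = peval (fun j => x 0 j) (q i).
Hypothesis y_deriv : forall x, D x -> forall t : R, 0 <= t -> forall i,
  is_derive t 1 (fun s => y x s i) (peval (y x t) (F i)).
Hypothesis y_bounded : forall i, polybounded D (fun x t => y x t i).
Hypothesis y_converges : forall i,
  converges_exp D (fun x t => peval (y x t) (G i)) (fun x => f x 0 i).

Let d := (m + #|{: option T}|)%N.
Let index (i : option T) : 'I_d := rshift m (enum_rank i).
Let coord (A : Type) (out : 'I_m -> A) (st : option T -> A) (i : 'I_d) : A :=
  match fintype.split i with inl j => out j | inr r => st (enum_val r) end.

Let coord_index A (out : 'I_m -> A) st i : coord out st (index i) = st i.
Proof.
rewrite /coord /index; case: split_ordP => j /eqP.
  by rewrite eq_rlshift.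
by rewrite eq_rshift => /eqP <-; rewrite enum_rankK.
Qed.

Let coord_lshift A (out : 'I_m -> A) st i : coord out st (lshift _ i) = out i.
Proof.
rewrite /coord; case: split_ordP => j /eqP; last by rewrite eq_lrshift.
by rewrite eq_lshift => /eqP <-.
Qed.

(** Driving the outputs by the Lie derivatives of the [G j] keeps them equal to [G j] along the
    solution. No right-hand side mentions an output or the clock, so expressions in [T] suffice. *)
Let field : 'I_d -> pexpr T :=
  coord (fun j => plie F (G j)) (fun i => if i is Some i then F i else PCst 1).
Let init : 'I_d -> pexpr 'I_n :=
  coord (fun j => psubst q (G j)) (fun i => if i is Some i then q i else PCst 0).
Let Y (x : 'rV[R]_n) (t : R) : 'rV[R]_d := \row_i
  coord (fun j => peval (y x t) (G j)) (fun i => if i is Some i then y x t i else t) i.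
Let p i := pexpr_mpoly (@ratr R) (fun i => index (Some i)) (field i).
Let q0 i := pexpr_mpoly (@ratr R) id (init i).

Let mpoly_mapY x t i : mpoly_map p (Y x t) 0 i = peval (y x t) (field i).
Proof.
rewrite mxE meval_pexpr_mpoly; apply: eq_peval => j /=.
by rewrite mxE coord_index.
Qed.

Let Y_deriv x (t : R) : D x -> 0 <= t -> is_derive t 1 (Y x) (mpoly_map p (Y x t)).
Proof.
move=> Dx t0; apply: is_derive_row => i; rewrite mpoly_mapY.
under eq_fun do rewrite mxE.
rewrite /field /coord; case: (fintype.split i) => j.
  by apply: is_derive_peval => k; exact: y_deriv.
case: (enum_val j) => [k|]; first exact: y_deriv.
by rewrite /= rmorph1; exact: is_derive_id.
Qed.

Let Y_init x : D x -> Y x 0 = mpoly_map q0 x.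
Proof.
move=> Dx; apply/rowP => i; rewrite !mxE meval_pexpr_mpoly /init /coord.
case: (fintype.split i) => j.
  rewrite peval_psubst; apply: eq_peval => k; exact: y_init.
by case: (enum_val j) => [k|]; [exact: y_init|rewrite /= rmorph0].
Qed.

Let Y_solves x : D x -> solves_on_Rplus p (Y x).
Proof.
move=> Dx; split=> [t t0|]; first by apply: Y_deriv => //; exact: ltW.
have dY := Y_deriv Dx (lexx 0).
have dY' : derivable (Y x) 0 1 by exact: ex_derive.
rewrite -(@derive_val _ _ _ _ _ _ _ dY).
(* The explicit solution has a two-sided derivative at 0, of which the right one is a
   restriction. *)
apply: cvg_dnbhs_at_right.
have e : (fun h : R => h^-1 *: ((Y x \o shift 0) (h *: (1 : R)) - Y x 0)) =
    fun h => h^-1 *: (Y x h - Y x 0).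
  by apply/funext => h /=; rewrite addr0 [_ *: 1]mulr1.
by move: dY'; rewrite /derive /derivable e.
Qed.

Let field_bounded : exists (C : R) (N : nat), 0 <= C /\
  forall x t, D x -> 0 <= t -> `|mpoly_map p (Y x t)| <= C * (1 + `|x|) ^+ N.
Proof.
have [|C [N [C0 CN]]] := @poly_le_uniform _ _ D _ (fun=> 1)
  (fun i x t => peval (y x t) (field i)) (fun=> ler01).
  by move=> i; exact: polybounded_peval.
exists C, N; split => // x t Dx t0.
apply: row_norm_le => [|i]; first by rewrite mulr_ge0// poly_weight_ge0.
by rewrite mpoly_mapY (le_trans (CN i x t Dx t0))// mulr1.
Qed.

Let output_converges : exists (C : R) (N : nat), 0 <= C /\
  forall x t, D x -> 0 <= t ->
  `|first_coords (leq_addr _ m) (Y x t) - f x| <=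
    C * (1 + `|x|) ^+ N * expR (- t).
Proof.
have [|C [N [C0 CN]]] := @poly_le_uniform _ _ D _ (fun t => expR (- t))
  (fun i x t => peval (y x t) (G i) - f x 0 i) (fun t => expR_ge0 _).
  exact: y_converges.
exists C, N; split => // x t Dx t0.
apply: row_norm_le => [|i].
  by rewrite !mulr_ge0// ?poly_weight_ge0// expR_ge0.
rewrite !mxE (_ : widen_ord _ _ = lshift _ i); last exact: val_inj.
by rewrite coord_lshift; exact: CN.
Qed.

Let Y_curve_len x t B : D x -> 0 <= t ->
  (forall s, 0 <= s -> `|mpoly_map p (Y x s)| <= B) ->
  (t%:E <= curve_len (Y x) t <= (B * t)%:E)%E.
Proof.
move=> Dx t0 YB; rewrite -[X in (X%:E <= _)%E]mul1r.
apply: (curve_len_bounds (v := fun s => mpoly_map p (Y x s))) => // [s s0| |s s0].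
- exact: Y_deriv.
- apply: continuous_in_subspaceT => s; rewrite inE/= in_itv/= => /andP[s0 _].
  apply: cvg_norm; apply: (continuous_comp (f := Y x)); last first.
    exact: mpoly_map_continuous.
  exact: (is_derive_continuous (Y_deriv Dx s0)).
- rewrite YB// andbT.
  have := coord_norm_le (mpoly_map p (Y x s)) (index None).
  by rewrite mpoly_mapY /field coord_index /= rmorph1 normr1.
Qed.

(** Let the speed be at most [B] and the output error at most [e exp (- t)], with [B] and [e]
    polynomial in [|x|], and put [Omega = B (mu + e)]. A length of at least [Omega] forces
    [t >= mu + e], and then [e <= exp e] bounds the error by [exp (- mu)]. *)
Lemma AP_of_system : AP K D f.
Proof.
have [C [N [C0 CN]]] := field_bounded.
have [E [M [E0 EM]]] := output_converges.
pose X0 : mpoly.mpoly 2 R := mpoly.mpolyX R (mpoly.mnm1 ord0).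
pose X1 : mpoly.mpoly 2 R := mpoly.mpolyX R (mpoly.mnm1 (lift ord0 ord0)).
pose W := 1 + X0.
exists d, (leq_addr _ m), p, q0,
  ((mpoly.mpolyC 2 C * W ^+ N + 1) * (X1 + mpoly.mpolyC 2 E * W ^+ M)).
split=> [i|i|x Dx]; [exact: pexpr_mpolyOver|exact: pexpr_mpolyOver|].
(* The added 1 makes the speed bound strictly positive, so that it can be cancelled from the
   inequality between lengths. *)
have YB s : 0 <= s -> `|mpoly_map p (Y x s)| <= C * (1 + `|x|) ^+ N + 1.
  by move=> s0; rewrite (le_trans (CN x s Dx s0))// lerDl.
exists (Y x); split; last first.
  move=> z [z0 sz _ _]; apply: solves_unique (Y_solves Dx) sz _.
  by rewrite z0 Y_init.
split; [exact: Y_init|exact: Y_solves| |]; last first.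
  by move=> t t0; have /andP[] := Y_curve_len Dx t0 YB.
move=> t mu t0 mu0.
rewrite !(mpoly.mevalM, mpoly.mevalD, mpoly.mevalC, rmorphXn, mpoly.mevalXU,
  rmorph1)/=.
have /andP[_ tB] := Y_curve_len Dx t0 YB.
move=> /le_trans/(_ tB); rewrite lee_fin.
have B0 : 0 < C * (1 + `|x|) ^+ N + 1.
  by rewrite ltr_wpDl// mulr_ge0// poly_weight_ge0.
have -> : mpoly.meval (tnth [tuple `|x|; mu]) W = 1 + `|x|.
  by rewrite mpoly.mevalD rmorph1 mpoly.mevalXU.
rewrite [tnth _ _]/= ler_pM2l// => mut; apply: (le_trans (EM x t Dx t0)).
set e := E * _ in mut *.
have e_exp : e <= expR e by rewrite (le_trans _ (expR_ge1Dx e))// lerDr.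
apply: (@le_trans _ _ (expR e * expR (- (mu + e)))).
  apply: ler_pM => //; first by rewrite mulr_ge0// poly_weight_ge0.
  by rewrite ler_expR lerN2.
by rewrite -expRD opprD addrC addrNK.
Qed.

End PolynomialSystems.

(** * The amplifying flow and its estimates *)

Section Amplifier.
Variable R : realType.
Implicit Types (l mu e : R).

(** The substitution [v^-2] makes Bernoulli's equation linear; this is its solution multiplied by
    [l^2]. *)
Definition amp_den l mu e : R := l ^+ 2 + (1 - l ^+ 2) * expR (2 * mu * (e - 1)).

(* Bernoulli's equation [v' = - mu (v - v^3)] in the variable [e], run backwards
   from [v = l] at [e = 1]: it drives [l] away from 0, towards its sign. *)
Definition amp l mu e : R := l / Num.sqrt (amp_den l mu e).

Lemma amp_expR_le1 mu e : 0 <= mu -> e <= 1 -> expR (2 * mu * (e - 1)) <= 1.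
Proof.
move=> mu0 e1; rewrite -[leRHS]expR0 ler_expR mulr_ge0_le0 ?mulr_ge0//.
by rewrite subr_le0.
Qed.

Lemma amp_den_gt0 l mu e : 0 <= mu -> e <= 1 -> 0 < amp_den l mu e.
Proof.
move=> mu0 e1; rewrite /amp_den.
have := amp_expR_le1 mu0 e1; have := expR_gt0 (2 * mu * (e - 1)).
set E := expR _ => E0 E1.
have -> : l ^+ 2 + (1 - l ^+ 2) * E = l ^+ 2 * (1 - E) + E by ring.
by rewrite ltr_wpDl// mulr_ge0 ?sqr_ge0 ?subr_ge0.
Qed.

Lemma amp1 l mu : amp l mu 1 = l.
Proof.
by rewrite /amp /amp_den subrr mulr0 expR0 mulr1 addrC subrK sqrtr1 divr1.
Qed.

Lemma is_derive_amp l mu (e : R -> R) (t de : R) : 0 <= mu -> e t <= 1 ->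
  is_derive t 1 e de ->
  is_derive t 1 (fun s => amp l mu (e s))
    (- mu * (amp l mu (e t) - amp l mu (e t) ^+ 3) * de).
Proof.
move=> mu0 e1 dedt; have N0 := amp_den_gt0 l mu0 e1.
have dN : is_derive t 1 (fun s => amp_den l mu (e s))
    (2 * mu * (amp_den l mu (e t) - l ^+ 2) * de).
  have := is_derive_add (is_derive_const (l ^+ 2) t)
    (is_derive_mul (is_derive_const (1 - l ^+ 2) t)
      (is_derive_expR_comp (is_derive_mul (is_derive_const (2 * mu) t)
        (is_derive_sub dedt (is_derive_const 1 t))))).
  by move/is_derive_eq; apply; rewrite /amp_den; ring.
have := is_derive_div_sqrt (g := fun s => amp_den l mu (e s)) N0 (is_derive_const l t) dN.
move/is_derive_eq; apply; rewrite /amp.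
have r0 : 0 < Num.sqrt (amp_den l mu (e t)) by rewrite sqrtr_gt0.
have rN : amp_den l mu (e t) = Num.sqrt (amp_den l mu (e t)) ^+ 2.
  by rewrite sqr_sqrtr// ltW.
move: r0 rN; set r := Num.sqrt _ => r0 ->.
by field; rewrite gt_eqF.
Qed.

(** The flow moves [|l|] towards 1 without crossing it, whence a bound independent of [mu] and [e].
    The proof is algebraic, by squaring. *)
Lemma amp_bound l mu e : 0 <= mu -> e <= 1 -> `|amp l mu e| <= 1 + `|l|.
Proof.
move=> mu0 e1; have N0 := amp_den_gt0 l mu0 e1.
rewrite /amp normrM normfV (ger0_norm (sqrtr_ge0 _)) ler_pdivrMr ?sqrtr_gt0//.
rewrite -[leLHS]sqrtr_sqr -[1 + _]ger0_norm ?addr_ge0// -[`|1 + _|]sqrtr_sqr.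
rewrite -sqrtrM ?sqr_ge0// ler_wsqrtr// /amp_den.
have := amp_expR_le1 mu0 e1; have := expR_gt0 (2 * mu * (e - 1)).
set E := expR _ => E0 E1.
rewrite -[l ^+ 2]real_normK ?num_real//; have := normr_ge0 l.
move: `|l| => a a0; rewrite -subr_ge0.
(* Since [0 < E <= 1] and [a >= 0], every product on the right-hand side is nonnegative. *)
have -> : (1 + a) ^+ 2 * (a ^+ 2 + (1 - a ^+ 2) * E) - a ^+ 2 =
  a ^+ 2 * (1 - E) * (2 * a + a ^+ 2) + E * (1 + 2 * a) by ring.
have Ege0 := ltW E0.
have a2 : 0 <= 2 * a by rewrite mulr_ge0.
have E1' : 0 <= 1 - E by rewrite subr_ge0.
by apply: addr_ge0; apply: mulr_ge0; rewrite ?mulr_ge0 ?sqr_ge0// addr_ge0 ?sqr_ge0.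
Qed.

(** Mean value theorem in the variable [e], the derivative being bounded through [amp_bound]. With
    [e = exp (- t)] this is an exponential rate. *)
Lemma amp_cvg l mu e : 0 <= mu -> 0 <= e <= 1 ->
  `|amp l mu e - amp l mu 0| <= mu * ((1 + `|l|) + (1 + `|l|) ^+ 3) * e.
Proof.
move=> mu0 /andP[e0 e1].
have da (s : R) : s <= 1 -> is_derive s 1 (amp l mu)
    (- mu * (amp l mu s - amp l mu s ^+ 3)).
  move=> s1; have := is_derive_amp l mu0 s1 (is_derive_id s (1 : R)).
  by rewrite mulr1.
have dI (s : R) : s \in `]0, e[ -> is_derive s 1 (amp l mu)
    (- mu * (amp l mu s - amp l mu s ^+ 3)).
  by rewrite in_itv/= => /andP[_ /ltW se]; apply: da; exact: le_trans se e1.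
have cI : {within `[0, e], continuous (amp l mu)}.
  apply: continuous_in_subspaceT => s; rewrite inE/= in_itv/= => /andP[_ se].
  by apply: is_derive_continuous (da _ _); exact: le_trans se e1.
have [c] := MVT_segment e0 dI cI.
rewrite in_itv/= => /andP[_ ce] ->; rewrite subr0 normrM (ger0_norm e0).
rewrite ler_wpM2r// normrM normrN (ger0_norm mu0) ler_wpM2l//.
have ab := amp_bound l mu0 (le_trans ce e1).
by rewrite (le_trans (ler_normB _ _))// normrX lerD// lerXn2r// nnegrE addr_ge0.
Qed.

(** At [e = 0] the exponential in [amp_den] is [exp (- mu)^2 <= l^2], so the denominator is at most
    [2 l^2], hence at most [(2 l)^2]. *)
Lemma amp_ge_half l mu : expR (- mu) <= l -> 0 <= mu -> 1 / 2 <= amp l mu 0.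
Proof.
move=> lmu mu0; have N0 := amp_den_gt0 l mu0 ler01.
have l0 : 0 < l by rewrite (lt_le_trans _ lmu)// expR_gt0.
rewrite /amp ler_pdivlMr ?sqrtr_gt0// mul1r mulrC ler_pdivrMr//.
have p0 : 0 <= l * 2 by rewrite mulr_ge0// ltW.
rewrite -[leRHS](ger0_norm p0) -sqrtr_sqr ler_wsqrtr// /amp_den.
have -> : 2 * mu * (0 - 1) = - mu + - mu by ring.
rewrite expRD.
have : expR (- mu) ^+ 2 <= l ^+ 2 by rewrite lerXn2r ?nnegrE ?expR_ge0// ltW.
have : 0 < expR (- mu) by exact: expR_gt0.
move: (expR (- mu)) => E E0 El; rewrite exprMn; nra.
Qed.

Lemma amp_le_half l mu : l <= - expR (- mu) -> 0 <= mu -> amp l mu 0 <= - (1 / 2).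
Proof.
rewrite lerNr => lmu mu0; rewrite lerNr.
have -> : - amp l mu 0 = amp (- l) mu 0 by rewrite /amp /amp_den sqrrN mulNr.
exact: amp_ge_half.
Qed.

End Amplifier.

(** * A smooth approximation of the absolute value and its differential system *)

Section RegularizedAbsoluteValue.
Variable R : realType.
Implicit Types (z e : R).

(* The constant 3 makes [absreg (+-1) 1] rational. *)
Definition absreg z e : R := Num.sqrt (z ^+ 2 + 3 * e ^+ 2).

Lemma absreg_init z : z ^+ 2 = 1 -> absreg z 1 = 2.
Proof.
move=> z1; rewrite /absreg z1 expr1n mulr1.
by rewrite (_ : 1 + 3 = 2 ^+ 2) ?sqrtr_sqr ?ger0_norm//; ring.
Qed.

Lemma absreg_arg_gt0 z e : 0 < e -> 0 < z ^+ 2 + 3 * e ^+ 2.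
Proof. by move=> e0; rewrite ltr_wpDl ?sqr_ge0// mulr_gt0// exprn_gt0. Qed.

Lemma absreg_gt0 z e : 0 < e -> 0 < absreg z e.
Proof. by move=> e0; rewrite sqrtr_gt0 absreg_arg_gt0. Qed.

(** The upper bound comes from [z^2 + 3 e^2 <= (|z| + 2 e)^2]. *)
Lemma absreg_near z e : 0 <= e -> `|absreg z e - `|z| | <= 2 * e.
Proof.
move=> e0; have zw : `|z| <= absreg z e.
  by rewrite -sqrtr_sqr ler_wsqrtr// lerDl mulr_ge0// sqr_ge0.
rewrite ger0_norm ?subr_ge0// lerBlDl.
have p0 : 0 <= `|z| + 2 * e by rewrite addr_ge0// mulr_ge0.
rewrite -[leRHS](ger0_norm p0) -sqrtr_sqr ler_wsqrtr//.
rewrite -[z ^+ 2]real_normK ?num_real//.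
have := normr_ge0 z; move: `|z| => a a0; nra.
Qed.

Lemma absreg_ratio1 z e : 0 < e -> `|z / absreg z e| <= 1.
Proof.
move=> e0; have w0 := absreg_gt0 z e0.
rewrite normrM normfV (gtr0_norm w0) ler_pdivrMr// mul1r.
by rewrite -sqrtr_sqr ler_wsqrtr// lerDl mulr_ge0// sqr_ge0.
Qed.

Lemma absreg_ratio2 z e : 0 < e -> `|e / absreg z e| <= 1.
Proof.
move=> e0; have w0 := absreg_gt0 z e0.
rewrite normrM normfV (gtr0_norm w0) ler_pdivrMr// mul1r.
rewrite -sqrtr_sqr ler_wsqrtr//; have := sqr_ge0 z; have := sqr_ge0 e.
move: (e ^+ 2) (z ^+ 2) => a b *; lra.
Qed.

Variables (z e : R -> R) (t P : R).
Hypotheses (e_gt0 : 0 < e t) (dz : is_derive t 1 z (e t * P))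
  (de : is_derive t 1 e (- e t)).
Let w := absreg (z t) (e t).

Let N s := z s ^+ 2 + 3 * e s ^+ 2.

Let dN : is_derive t 1 N
  (2 * e t * (z t * P - 3 * e t)).
Proof.
have := is_derive_add (is_derive_mul dz dz)
  (is_derive_mul (is_derive_const 3 t) (is_derive_mul de de)).
by move/is_derive_eq; apply; ring.
Qed.

Let w_gt0 : 0 < w. Proof. exact: absreg_gt0. Qed.

Let sqrtN : Num.sqrt (N t) = w. Proof. by []. Qed.

Let Nw : N t = w ^+ 2.
Proof. by rewrite /w sqr_sqrtr// ltW// absreg_arg_gt0. Qed.

(** Both [z'] and [e'] have the factor [e]. In this derivative and in the next two, [1 / w], which
    may grow exponentially, therefore occurs only inside the bounded ratios [z / w] and [e / w]. *)
Lemma is_derive_absreg : is_derive t 1 (fun s => absreg (z s) (e s))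
  (e t * (z t / w * P - 3 * (e t / w))).
Proof.
have := is_derive_sqrt_comp (g := N) (absreg_arg_gt0 (z t) e_gt0) dN.
move/is_derive_eq; apply; rewrite sqrtN.
by field; rewrite gt_eqF.
Qed.

Lemma is_derive_absreg_ratio1 : is_derive t 1 (fun s => z s / absreg (z s) (e s))
  (e t / w * P - z t / w * (e t / w) * (z t / w * P - 3 * (e t / w))).
Proof.
have := is_derive_div_sqrt (g := N) (absreg_arg_gt0 (z t) e_gt0) dz dN.
move/is_derive_eq; apply; rewrite sqrtN Nw.
by field; rewrite gt_eqF.
Qed.

Lemma is_derive_absreg_ratio2 : is_derive t 1 (fun s => e s / absreg (z s) (e s))
  (- (e t / w) - e t / w * (e t / w) * (z t / w * P - 3 * (e t / w))).
Proof.
have := is_derive_div_sqrt (g := N) (absreg_arg_gt0 (z t) e_gt0) de dN.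
move/is_derive_eq; apply; rewrite sqrtN Nw.
by field; rewrite gt_eqF.
Qed.

End RegularizedAbsoluteValue.

(** * A polynomial system computing polynomials in the inputs and in threshold tests *)

Section ThresholdSystem.
Variables (R : realType) (K : {pred R}) (n m : nat) (imu : 'I_n).
Variables (J : finType) (L : J -> pexpr 'I_n) (G : 'I_m -> pexpr ('I_n + J)).
Hypothesis K_divring : GRing.divring_closed K.

Let arg (x : 'rV[R]_n) j : R := peval (fun i => x 0 i) (L j).

Definition threshold (l mu : R) : R :=
  1 / 2 + (`|2 * amp l mu 0 + 1| - `|2 * amp l mu 0 - 1|) / 4.

Definition threshold_env (x : 'rV[R]_n) (u : 'I_n + J) : R :=
  match u with inl i => x 0 i | inr j => threshold (arg x j) (x 0 imu) end.

Let D : set 'rV[R]_n := [set x | 0 <= x 0 imu].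

(* Inputs and [exp (- t)]; then the amplified arguments; then, for both signs,
   the regularized absolute value [w] of [z], and the ratios [z / w] and
   [exp (- t) / w]. *)
Let var := (('I_n + unit) + (J + (J * bool + J * bool + J * bool)))%type.

Let sgnb (b : bool) : rat := if b then 1 else -1.
Let vE : pexpr var := PVar (inl (inr tt)).
Let vM : pexpr var := PVar (inl (inl imu)).
Let vA j : pexpr var := PVar (inr (inl j)).
Let vW jb : pexpr var := PVar (inr (inr (inl (inl jb)))).
Let vS jb : pexpr var := PVar (inr (inr (inl (inr jb)))).
Let vU jb : pexpr var := PVar (inr (inr (inr jb))).
Let psub (P Q : pexpr var) := PAdd P (PMul (PCst (-1)) Q).
Let cubic j := psub (vA j) (PMul (vA j) (PMul (vA j) (vA j))).
(** The derivative of [z] below is [exp (- t)] times this; it plays the role of [P] in the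
    derivatives of [absreg]. *)
Let slope j :=
  PMul (PCst 2) (PAdd (PMul vM (PMul (cubic j) (psub (PCst 1) vE))) (vA j)).
Let wslope (jb : J * bool) :=
  psub (PMul (vS jb) (slope jb.1)) (PMul (PCst 3) (vU jb)).

Let field (u : var) : pexpr var :=
  match u with
  | inl (inl _) => PCst 0
  | inl (inr _) => PMul (PCst (-1)) vE
  | inr (inl j) => PMul vE (PMul vM (cubic j))
  | inr (inr (inl (inl jb))) => PMul vE (wslope jb)
  | inr (inr (inl (inr jb))) =>
      psub (PMul (vU jb) (slope jb.1)) (PMul (PMul (vS jb) (vU jb)) (wslope jb))
  | inr (inr (inr jb)) =>
      psub (PMul (PCst (-1)) (vU jb)) (PMul (PMul (vU jb) (vU jb)) (wslope jb))
  end.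

Let init (u : var) : pexpr 'I_n :=
  match u with
  | inl (inl i) => PVar i
  | inl (inr _) => PCst 1
  | inr (inl j) => L j
  | inr (inr (inl (inl _))) => PCst 2
  | inr (inr (inl (inr jb))) => PCst (sgnb jb.2 / 2)
  | inr (inr (inr _)) => PCst (1 / 2)
  end.

Let a (x : 'rV[R]_n) j t : R := amp (arg x j) (x 0 imu) (expR (- t)).
(** The factor [1 - exp (- t)] makes [z] start at 1 or -1 whatever the input, so that the root and
    both ratios have rational initial values; the limit is still [2 v + 1] or [2 v - 1]. *)
Let z (x : 'rV[R]_n) (jb : J * bool) t : R :=
  2 * (a x jb.1 t * (1 - expR (- t))) + ratr (sgnb jb.2).

Let y (x : 'rV[R]_n) (t : R) (u : var) : R :=
  match u with
  | inl (inl i) => x 0 i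
  | inl (inr _) => expR (- t)
  | inr (inl j) => a x j t
  | inr (inr (inl (inl jb))) => absreg (z x jb t) (expR (- t))
  | inr (inr (inl (inr jb))) => z x jb t / absreg (z x jb t) (expR (- t))
  | inr (inr (inr jb)) => expR (- t) / absreg (z x jb t) (expR (- t))
  end.

Let outsub (u : 'I_n + J) : pexpr var :=
  match u with
  | inl i => PVar (inl (inl i))
  | inr j => PAdd (PCst (1 / 2))
      (PMul (PCst (1 / 4)) (psub (vW (j, true)) (vW (j, false))))
  end.

Let ratr_cst : (ratr 1 = 1 :> R) * (ratr 2 = 2 :> R) * (ratr 3 = 3 :> R) *
  (ratr (-1) = -1 :> R) * (ratr (1 / 2) = 1 / 2 :> R) *
  (ratr (1 / 4) = 1 / 4 :> R) * (ratr 0 = 0 :> R).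
Proof.
by rewrite !(rmorphN, rmorph1, rmorph0, fmorph_div, rmorph_nat).
Qed.

Let expRN_le1 (t : R) : 0 <= t -> expR (- t) <= 1.
Proof. by move=> t0; rewrite -[leRHS]expR0 ler_expR oppr_le0. Qed.

Let ratr_sgnb b : ratr (sgnb b) ^+ 2 = 1 :> R.
Proof. by case: b; rewrite /= !ratr_cst ?sqrrN expr1n. Qed.

Let y_init x : D x -> forall u, y x 0 u = peval (fun i => x 0 i) (init u).
Proof.
have z0 jb : z x jb 0 = ratr (sgnb jb.2).
  by rewrite /z oppr0 expR0 subrr !mulr0 add0r.
move=> Dx [[i|[]]|[j|[[jb|jb]|jb]]] /=; rewrite ?ratr_cst ?z0 ?oppr0 ?expR0.
- by [].
- by [].
- by rewrite /a oppr0 expR0 amp1.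
- by rewrite absreg_init.
- by rewrite absreg_init// fmorph_div rmorph_nat.
- by rewrite absreg_init.
Qed.

Let de (t : R) : is_derive t 1 (fun s => expR (- s)) (- expR (- t)).
Proof.
have := is_derive_expR_comp (is_derive_sub (is_derive_const 0 t) (is_derive_id t (1 : R))).
under eq_fun do rewrite sub0r.
by move/is_derive_eq; apply; rewrite !sub0r mulrN1.
Qed.

Let da x (t : R) j : D x -> 0 <= t ->
  is_derive t 1 (a x j) (expR (- t) * (x 0 imu * (a x j t - a x j t ^+ 3))).
Proof.
move=> Dx t0; have := is_derive_amp (e := fun s => expR (- s)) (arg x j) Dx
  (expRN_le1 t0) (de t).
by move/is_derive_eq; apply; rewrite -/(a x j t); ring.
Qed.

Let dz x (t : R) jb : D x -> 0 <= t ->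
  is_derive t 1 (z x jb) (expR (- t) * peval (y x t) (slope jb.1)).
Proof.
move=> Dx t0.
have := is_derive_add (is_derive_mul (is_derive_const 2 t)
  (is_derive_mul (da jb.1 Dx t0) (is_derive_sub (is_derive_const 1 t) (de t))))
  (is_derive_const (ratr (sgnb jb.2)) t).
by move/is_derive_eq; apply; rewrite /= !ratr_cst; ring.
Qed.

Let y_deriv x : D x -> forall t : R, 0 <= t -> forall u,
  is_derive t 1 (fun s => y x s u) (peval (y x t) (field u)).
Proof.
move=> Dx t t0; have e0 := expR_gt0 (- t).
move=> [[i|[]]|[j|[[jb|jb]|jb]]] /=; rewrite ?ratr_cst.
- exact: is_derive_const.
- by rewrite mulN1r; exact: de.
- by apply: is_derive_eq; [exact: da|ring].
- apply: (is_derive_eq (is_derive_absreg (e := fun s => expR (- s)) e0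
    (dz jb Dx t0) (de t))).
  by rewrite /= !ratr_cst; ring.
- apply: (is_derive_eq (is_derive_absreg_ratio1 (e := fun s => expR (- s)) e0
    (dz jb Dx t0) (de t))).
  by rewrite /= !ratr_cst; ring.
- apply: (is_derive_eq (is_derive_absreg_ratio2 (e := fun s => expR (- s)) e0
    (dz jb Dx t0) (de t))).
  by rewrite /= !ratr_cst; ring.
Qed.

Let arg_bounded j : polybounded D (fun x _ => 1 + `|arg x j|).
Proof.
apply: polyboundedD; first exact: polybounded_cst.
have : polybounded D (fun x _ => arg x j).
  apply: (@polybounded_peval _ _ D _ (fun x _ i => x 0 i)) => i.
  exact: polybounded_coord.
by move=> /poly_leW; apply => x t _ _; rewrite normr_id.
Qed.

Let exp_bounded : polybounded D (fun _ t => expR (- t)).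
Proof.
have := polybounded_cst D 1 => /poly_leW; apply => x t _ t0.
by rewrite ger0_norm ?expR_ge0// normr1 expRN_le1.
Qed.

Let a_bounded j : polybounded D (fun x t => a x j t).
Proof.
have := arg_bounded j => /poly_leW; apply => x t Dx t0.
by rewrite (le_trans (amp_bound _ Dx (expRN_le1 t0)))// ler_norm.
Qed.

Let z_bounded jb : polybounded D (fun x t => z x jb t).
Proof.
apply: polyboundedD; last exact: polybounded_cst.
apply: polyboundedM; first exact: polybounded_cst.
apply: polyboundedM; first exact: a_bounded.
apply: polyboundedD; first exact: polybounded_cst.
by have := exp_bounded => /poly_leW; apply => x t _ _; rewrite normrN.
Qed.

Let y_bounded u : polybounded D (fun x t => y x t u).
Proof.
case: u => [[i|[]]|[j|[[jb|jb]|jb]]] /=.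
- exact: polybounded_coord.
- exact: exp_bounded.
- exact: a_bounded.
- have b : polybounded D (fun x t => `|z x jb t| + 2).
    apply: polyboundedD; last exact: polybounded_cst.
    by have := z_bounded jb => /poly_leW; apply => x t _ _; rewrite normr_id.
  have := b => /poly_leW; apply => x t Dx t0.
  have := absreg_near (z x jb t) (expR_ge0 (- t)); have := expRN_le1 t0.
  rewrite (ger0_norm (_ : 0 <= `|z x jb t| + 2)) ?addr_ge0//.
  move=> e1 near; have := ler_normD (absreg (z x jb t) (expR (- t)) - `|z x jb t|)
    `|z x jb t|; rewrite subrK normr_id => /le_trans; apply.
  rewrite addrC lerD2l (le_trans near)// -[leRHS]mulr1 ler_wpM2l//.
- have := polybounded_cst D 1 => /poly_leW; apply => x t _ t0.
  by rewrite normr1 absreg_ratio1// expR_gt0.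
- have := polybounded_cst D 1 => /poly_leW; apply => x t _ t0.
  by rewrite normr1 absreg_ratio2// expR_gt0.
Qed.

(** Two errors add up: regularization costs [2 exp (- t)], and the distance from [z] to its limit
    combines the rate of [amp_cvg] with the vanishing factor [1 - exp (- t)] in [z]. The function
    [B] collects both coefficients. *)
Let w_converges jb : converges_exp D
  (fun x t => absreg (z x jb t) (expR (- t)))
  (fun x => `|2 * amp (arg x jb.1) (x 0 imu) 0 + ratr (sgnb jb.2)|).
Proof.
pose A (x : 'rV[R]_n) (t : R) := 1 + `|arg x jb.1|.
have bA : polybounded D A by exact: arg_bounded.
have ex : poly_le D (fun t => expR (- t)) (fun _ t => expR (- t)).
  exists 1, 0%N; split => // x t _ _.
  by rewrite ger0_norm ?expR_ge0// expr0 !mul1r.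
pose B (x : 'rV[R]_n) (t : R) :=
  2 + 2 * (x 0 imu * (A x t + A x t * (A x t * A x t)) + A x t).
have bB : polybounded D B.
  apply: polyboundedD; first exact: polybounded_cst.
  apply: polyboundedM; first exact: polybounded_cst.
  apply: polyboundedD; last exact: bA.
  apply: polyboundedM; first exact: polybounded_coord.
  apply: polyboundedD; first exact: bA.
  apply: polyboundedM; first exact: bA.
  by apply: polyboundedM; exact: bA.
have := poly_leM bB ex.
rewrite (_ : (fun t => 1 * expR (- t)) = fun t => expR (- t)); last first.
  by apply/funext => t; rewrite mul1r.
move=> /poly_leW; apply => x t Dx t0.
set l := arg x jb.1; set mu := x 0 imu; set s := ratr _.
have e0 := expR_ge0 (- t); have e1 := expRN_le1 t0.
have h1 := absreg_near (z x jb t) e0.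
have h2 : `|amp l mu (expR (- t)) - amp l mu 0| <=
    mu * (1 + `|l| + (1 + `|l|) ^+ 3) * expR (- t).
  by apply: amp_cvg => //; rewrite e0.
have h3 := amp_bound l Dx e1.
rewrite (le_trans _ (ler_norm _))//.
have -> : absreg (z x jb t) (expR (- t)) - `|2 * amp l mu 0 + s| =
    (absreg (z x jb t) (expR (- t)) - `|z x jb t|) +
    (`|z x jb t| - `|2 * amp l mu 0 + s|) by ring.
rewrite (le_trans (ler_normD _ _))// /B [leRHS]mulrDl lerD//.
rewrite (le_trans (ler_dist_dist _ _))//.
have -> : z x jb t - (2 * amp l mu 0 + s) =
    2 * ((a x jb.1 t - amp l mu 0) - a x jb.1 t * expR (- t)).
  by rewrite /z /s; ring.
rewrite normrM normr_nat -mulrA ler_wpM2l// [leRHS]mulrDl.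
rewrite (le_trans (ler_normB _ _))// lerD//.
by rewrite normrM (ger0_norm e0); apply: ler_wpM2r.
Qed.

Let outsub_converges u : converges_exp D
  (fun x t => peval (y x t) (outsub u)) (fun x => threshold_env x u).
Proof.
case: u => [i|j] /=; first exact: converges_exp_cst.
have cst c : converges_exp D (fun _ _ => c) (fun=> c).
  exact: (converges_exp_cst D (fun=> c)).
rewrite !ratr_cst.
have -> : (fun x => threshold (arg x j) (x 0 imu)) = fun x => 1 / 2 + 1 / 4 *
    (`|2 * amp (arg x j) (x 0 imu) 0 + ratr (sgnb true)| +
     -1 * `|2 * amp (arg x j) (x 0 imu) 0 + ratr (sgnb false)|).
  by apply/funext => x; rewrite /threshold /= !ratr_cst; field.
apply: converges_expD; first exact: cst.
apply: converges_expZ; apply: converges_expD; first exact: (w_converges (j, true)).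
by apply: converges_expZ; exact: (w_converges (j, false)).
Qed.

Lemma AP_threshold : AP K D (fun x => \row_i peval (threshold_env x) (G i)).
Proof.
apply: (@AP_of_system _ K n m D var field init (fun i => psubst outsub (G i)) y)
  => // [i].
under eq_fun do under eq_fun do rewrite peval_psubst.
under [X in converges_exp _ _ X]eq_fun do rewrite mxE.
apply: (converges_exp_peval (y := fun x t u => peval (y x t) (outsub u))) => u.
  exact: polybounded_peval.
exact: outsub_converges.
Qed.

End ThresholdSystem.

(** * Exactness of the threshold outside the uncertainty interval *)

Section ThresholdValues.
Variable R : realType.

Lemma threshold_eq1 (l mu : R) : 0 <= mu -> expR (- mu) <= l ->
  threshold l mu = 1.
Proof.
move=> mu0 /amp_ge_half/(_ mu0); rewrite /threshold; set v := amp _ _ _ => v2.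
by rewrite !ger0_norm; [field|lra|lra].
Qed.

Lemma threshold_eq0 (l mu : R) : 0 <= mu -> l <= - expR (- mu) ->
  threshold l mu = 0.
Proof.
move=> mu0 /amp_le_half/(_ mu0); rewrite /threshold; set v := amp _ _ _ => v2.
by rewrite !ler0_norm; [field|lra|lra].
Qed.

End ThresholdValues.

(** * Words as numbers: first digit, tail and the gap between values *)

Section WordValue.
Variables (R : realType) (k : nat) (M : turing_machine k).
Hypothesis k_ge2 : (2 <= k)%N.
Implicit Type w : seq (symbol M).

(** The value 0 on the empty word lets [word_val_behead] hold without exception. *)
Definition first_digit w : nat := if w is s :: _ then digit s else 0%N.

Lemma digit_inj : injective (@digit k M).
Proof. by move=> s t st; do 2!apply: val_inj. Qed.

(** A first digit 0 means either the empty word, read as the blank, or a symbol of digit 0, which is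
    the blank by [blank_digit0]. Either way the digit read is that of the blank. *)
Lemma digit_head w : digit (head (blank M) w) =
  (first_digit w + (first_digit w == 0) * digit (blank M))%N.
Proof.
case: w => [|s w] /=; first by rewrite add0n mul1n.
have [s0|_] := eqVneq (digit s) 0%N; last first.
  by rewrite mul0n addn0.
by rewrite -(blank_digit0 s0) s0.
Qed.

Lemma digit_lt (s : symbol M) : (digit s + 2 <= k)%N.
Proof. by have := ltn_ord (val s); rewrite -/(digit s); lia. Qed.

Lemma first_digit_lt w : (first_digit w + 2 <= k)%N.
Proof. by case: w => [//|s w]; exact: digit_lt. Qed.

Let k_gt0 : 0 < k%:R :> R. Proof. by rewrite ltr0n; lia. Qed.

Lemma word_val_cons s w :
  word_val R (s :: w) = ((digit s)%:R + word_val R w) / k%:R.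
Proof.
rewrite /word_val big_ord_recl /= expr1 mulrDl; congr (_ + _).
rewrite big_distrl; apply: eq_bigr => i _ /=.
by rewrite /bump /= add1n [in LHS]exprS invfM mulrCA mulrC.
Qed.

Lemma word_val_nil : word_val R ([::] : seq (symbol M)) = 0.
Proof. by rewrite /word_val big_ord0. Qed.

Lemma word_val_behead w :
  k%:R * word_val R w = (first_digit w)%:R + word_val R (behead w).
Proof.
case: w => [|s w] /=; first by rewrite word_val_nil mulr0 addr0.
by rewrite word_val_cons mulrC divfK// gt_eqF.
Qed.

(* Digits are at most [k - 2]: this is the gap that makes rounding possible. *)
Lemma word_val_bounds w : 0 <= word_val R w <= 1 - k%:R^-1.
Proof.
have k1 : k%:R^-1 <= 1 :> R by rewrite invf_le1// ler1n; lia.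
have ki0 : 0 <= k%:R^-1 :> R by rewrite invr_ge0 ltW.
elim: w => [|s w /andP[w0 w1]]; first by rewrite word_val_nil lexx subr_ge0.
rewrite word_val_cons divr_ge0 ?addr_ge0//=.
rewrite ler_pdivrMr// mulrBl mul1r mulVf ?gt_eqF//.
have : (digit s)%:R + 2 <= k%:R :> R by rewrite -natrD ler_nat digit_lt.
lra.
Qed.

End WordValue.

(** * The step function as a polynomial in the input and in threshold tests *)

Section RealStep.
Variables (R : realType) (k : nat) (M : turing_machine k).
Hypothesis k_ge2 : (2 <= k)%N.

Let n := (4 + 1)%N.
Let input (i : 'I_4) : 'I_n := lshift 1 i.
Definition mu_index : 'I_(4 + 1) := rshift 4 ord0.
Let is_tape (i : 'I_4) := ~~ odd i.
Let scale (i : 'I_4) : rat := if is_tape i then k%:R else 1.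
Let offset (i : 'I_4) : rat := if is_tape i then 1 / (2 * k%:R) else 1 / 2.
(** Larger than every digit and every state number, so that one range of tests serves all four
    coordinates. The index type [J] has one more test, because [digit_is] at [d] also needs the one
    at [d.+1]. *)
Let bound := (k + nstates M)%N.
Let J := ('I_4 * 'I_bound.+1)%type.

(** Its sign tells whether the rounded coordinate [ij.1] is at least [ij.2]. *)
Definition rounding_arg (ij : J) : pexpr 'I_(4 + 1) :=
  PAdd (PMul (PCst (scale ij.1)) (PVar (input ij.1)))
    (PCst (offset ij.1 - (nat_of_ord ij.2)%:R)).

Let var := ('I_n + J)%type.
Let above (i : 'I_4) (d : nat) : pexpr var := PVar (inr (i, inord d)).
Let digit_is (i : 'I_4) (d : nat) : pexpr var :=
  PAdd (above i d) (PMul (PCst (-1)) (above i d.+1)).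
Let X (i : 'I_4) : pexpr var := PVar (inl (input i)).
Let digit_of (i : 'I_4) : pexpr var :=
  psum (iota 0 bound) (fun d => PMul (PCst d%:R) (digit_is i d)).
(* The digit 0 stands for the empty word, which reads as the blank; if it is a
   tape symbol, it is the blank too. *)
Let symbol_of (i : 'I_4) : pexpr var :=
  PAdd (digit_of i) (PMul (PCst (digit (blank M))%:R) (digit_is i 0)).
Let pop (i : 'I_4) : pexpr var :=
  PAdd (PMul (PCst k%:R) (X i)) (PMul (PCst (-1)) (digit_of i)).
Let push (s : symbol M) (i : 'I_4) : pexpr var :=
  PMul (PCst (1 / k%:R)) (PAdd (PCst (digit s)%:R) (X i)).

Let i0 : 'I_4 := inord 0.
Let i1 : 'I_4 := inord 1.
Let i2 : 'I_4 := inord 2.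
Let i3 : 'I_4 := inord 3.

Let step (qs : 'I_(nstates M) * symbol M) : seq (pexpr var) :=
  let: (q', s', mv) := delta qs.1 qs.2 in
  match mv with
  | MoveL => [:: pop i0; symbol_of i0; push s' i2; PCst (nat_of_ord q')%:R]
  | Stay => [:: X i0; PCst (digit s')%:R; X i2; PCst (nat_of_ord q')%:R]
  | MoveR => [:: push s' i0; symbol_of i2; pop i2; PCst (nat_of_ord q')%:R]
  end.

(** The transition table as a polynomial: each entry is multiplied by the indicator of its state and
    symbol, and only the current pair contributes. *)
Definition step_expr (i : 'I_4) : pexpr ('I_(4 + 1) + J) :=
  psum (index_enum {: 'I_(nstates M) * symbol M}) (fun qs =>
    PMul (PMul (digit_is i3 qs.1) (digit_is i1 (digit qs.2)))
      (nth (PCst 0) (step qs) i)).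

Let digits (c : config M) : seq nat :=
  [:: first_digit (tape_left c); digit (head_symbol c);
      first_digit (tape_right c); nat_of_ord (state c)].

Let codes (c : config M) : seq R :=
  [:: word_val R (tape_left c); (digit (head_symbol c))%:R;
      word_val R (tape_right c); (state c)%:R].

Let encodeE c i : encode R c 0 i = nth 0 (codes c) i.
Proof. by rewrite mxE (tnth_nth 0). Qed.

Let kR_ge2 : 2 <= k%:R :> R. Proof. by rewrite ler_nat. Qed.

Let digits_lt c (i : 'I_4) : (nth 0%N (digits c) i < bound)%N.
Proof.
rewrite /bound; have [q s] := (ltn_ord (state c), digit_lt k_ge2 (head_symbol c)).
have l := first_digit_lt k_ge2 (tape_left c).
have r := first_digit_lt k_ge2 (tape_right c).
by case: i => [[|[|[|[|]]]] //=] _; lia.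
Qed.

Variables (c : config M) (mu : R) (cbar : 'rV[R]_4).
Hypothesis mu_ge0 : 0 <= mu.
Let eps := `|encode R c - cbar|.
Hypothesis eps_le : eps <= (2 * k%:R ^+ 2)^-1 - expR (- mu).

Let x : 'rV[R]_(4 + 1) := row_mx cbar (mu%:M : 'rV[R]_1).
Let env := threshold_env mu_index rounding_arg x.

Let x_input i : x 0 (input i) = cbar 0 i.
Proof. by rewrite row_mxEl. Qed.

Let x_mu : x 0 mu_index = mu.
Proof. by rewrite row_mxEr mxE mulr1n. Qed.

Let close (i : 'I_4) : `|cbar 0 i - nth 0 (codes c) i| <= eps.
Proof. by rewrite -encodeE distrC coord_normB_le. Qed.

(** On a tape, [k * 0.w] is the first digit plus a tail in [[0, 1 - 1/k]]; the offset [1/(2k)]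
    centres it, leaving room [1/(2k)] on each side. The input error becomes at most
    [k (1/(2k^2) - exp (- mu))], so at least [k exp (- mu)] remains. For symbol and state, the room
    is [1/2]. *)
Let margin (i : 'I_4) : (nth 0%N (digits c) i)%:R + expR (- mu) <=
    ratr (scale i) * cbar 0 i + ratr (offset i) <=
    (nth 0%N (digits c) i)%:R + 1 - expR (- mu).
Proof.
have E0 := expR_gt0 (- mu); have k2 := kR_ge2.
move: (expR (- mu)) eps_le E0 => E epsE E0.
have k0 : 0 < k%:R :> R by apply: lt_le_trans kR_ge2.
have tape (w : seq (symbol M)) (u : R) : `|u - word_val R w| <= eps ->
    (first_digit w)%:R + E <= k%:R * u + 1 / (2 * k%:R) <=
    (first_digit w)%:R + 1 - E.
  move=> /le_trans/(_ epsE); rewrite ler_norml => /andP[u1 u2].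
  have := word_val_behead R k_ge2 w.
  have /andP[b0 b1] := word_val_bounds R k_ge2 (behead w).
  have e1 : 1 / (2 * k%:R) = k%:R^-1 / 2 :> R by field; rewrite gt_eqF.
  have e2 : k%:R * (2 * k%:R ^+ 2)^-1 = k%:R^-1 / 2 :> R by field; rewrite gt_eqF.
  rewrite e1 => kw.
  have kE : E <= k%:R * E by rewrite ler_peMl//; [exact: ltW|lra].
  have := ler_wpM2l (ltW k0) u1; have := ler_wpM2l (ltW k0) u2.
  rewrite opprB !mulrBr e2 kw => h2 h1.
  by apply/andP; split; lra.
have exact_ (a : nat) (u : R) : `|u - a%:R| <= eps ->
    a%:R + E <= 1 * u + 1 / 2 <= a%:R + 1 - E.
  move=> /le_trans/(_ epsE); rewrite ler_norml => /andP[u1 u2].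
  have : (2 * k%:R ^+ 2)^-1 <= 1 / 2 :> R.
    rewrite mul1r lef_pV2 ?posrE ?mulr_gt0 ?exprn_gt0//.
    by rewrite ler_peMr// exprn_ege1//; lra.
  by move=> h; apply/andP; split; lra.
have := close i; rewrite /scale /offset /is_tape.
case: i => [[|[|[|[|]]]] //= p] h;
  rewrite ?(rmorph1, fmorph_div, rmorphM, rmorph_nat)/=.
- exact: tape.
- exact: exact_.
- exact: tape.
- exact: exact_.
Qed.

Let eval_above i d : (d <= bound)%N ->
  peval env (above i d) = (d <= nth 0%N (digits c) i)%:R.
Proof.
move=> db; rewrite /= /rounding_arg /= x_input x_mu inordK//.
rewrite rmorphB rmorph_nat /= addrA.
have /andP[m1 m2] := margin i; have E0 := expR_gt0 (- mu).
have [dd|dd] := leqP d (nth 0%N (digits c) i).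
  apply: threshold_eq1 => //.
  by have : d%:R <= (nth 0%N (digits c) i)%:R :> R by [rewrite ler_nat]; lra.
apply: threshold_eq0 => //.
have : (nth 0%N (digits c) i)%:R + 1 <= d%:R :> R by rewrite natr1 ler_nat.
lra.
Qed.

Let eval_digit_is i d : (d < bound)%N ->
  peval env (digit_is i d) = (d == nth 0%N (digits c) i)%:R.
Proof.
move=> db; rewrite -[LHS]/(peval env (above i d) + ratr (-1) * peval env (above i d.+1)).
rewrite !eval_above//; last exact: ltnW.
rewrite rmorphN rmorph1 mulN1r.
by case: ltngtP => _; rewrite /= ?subrr ?subr0.
Qed.

Let eval_digit_of (i : 'I_4) : peval env (digit_of i) = (nth 0%N (digits c) i)%:R.
Proof.
have e d : (d < bound)%N -> peval env (PMul (PCst d%:R) (digit_is i d)) =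
    d%:R * (d == nth 0%N (digits c) i)%:R.
  move=> db; rewrite -[LHS]/(ratr _ * peval env (digit_is i d)).
  by rewrite eval_digit_is// rmorph_nat.
rewrite peval_psum (eq_big_seq (fun d => d%:R * (d == nth 0%N (digits c) i)%:R)).
  rewrite (bigD1_seq (nth 0%N (digits c) i)) ?iota_uniq//=; last first.
    by rewrite mem_iota add0n digits_lt.
  by rewrite eqxx mulr1 big1 ?addr0// => d /negPf ->; rewrite mulr0.
by move=> d; rewrite mem_iota add0n => db; exact: e.
Qed.

Let eval_symbol_of (i : 'I_4) (w : seq (symbol M)) :
  nth 0%N (digits c) i = first_digit w ->
  peval env (symbol_of i) = (digit (head (blank M) w))%:R.
Proof.
move=> iw; rewrite digit_head natrD natrM -iw.
rewrite -[LHS]/(peval env (digit_of i) + ratr _ * peval env (digit_is i 0)).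
rewrite eval_digit_of eval_digit_is ?rmorph_nat; last by rewrite /bound; lia.
by rewrite mulrC eq_sym.
Qed.

(** The tests are exactly 0 or 1, and [digit] is injective, so the sum reduces to a single term. *)
Let eval_step_expr (i : 'I_4) : peval env (step_expr i) =
  peval env (nth (PCst 0) (step (state c, head_symbol c)) i).
Proof.
have di3 : nth 0%N (digits c) i3 = state c by rewrite inordK.
have di1 : nth 0%N (digits c) i1 = digit (head_symbol c) by rewrite inordK.
have e (qs : 'I_(nstates M) * symbol M) : peval env (PMul (digit_is i3 qs.1)
    (digit_is i1 (digit qs.2))) = (qs == (state c, head_symbol c))%:R.
  rewrite -[LHS]/(peval env (digit_is i3 _) * peval env (digit_is i1 _)).
  have q_lt := ltn_ord qs.1; have s_lt := digit_lt k_ge2 qs.2.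
  rewrite !eval_digit_is ?/bound; [|lia..].
  case: qs {q_lt s_lt} => q s /=; rewrite di3 di1 -natrM mulnb xpair_eqE.
  by rewrite (inj_eq (@digit_inj _ _)).
have e2 (qs : 'I_(nstates M) * symbol M) :
    peval env (PMul (PMul (digit_is i3 qs.1) (digit_is i1 (digit qs.2)))
    (nth (PCst 0) (step qs) i)) =
    (qs == (state c, head_symbol c))%:R * peval env (nth (PCst 0) (step qs) i).
  by rewrite -e.
rewrite peval_psum (eq_bigr _ (fun qs _ => e2 qs)).
rewrite (bigD1 (state c, head_symbol c))//= eqxx mul1r.
by rewrite big1 ?addr0// => qs /negPf ->; rewrite mul0r.
Qed.

(** The digit subtracted is exact, so the only error is the input error scaled by [k]: this is the
    source of the factor [k] in the final bound. *)
Let eval_pop (i : 'I_4) (w : seq (symbol M)) :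
  nth 0 (codes c) i = word_val R w ->
  nth 0%N (digits c) i = first_digit w ->
  `|peval env (pop i) - word_val R (behead w)| <= k%:R * eps.
Proof.
move=> cw dw; have := close i; rewrite cw => h.
rewrite -[peval env _]/(ratr k%:R * x 0 (input i) +
  ratr (-1) * peval env (digit_of i)).
rewrite eval_digit_of dw x_input rmorph_nat rmorphN rmorph1 mulN1r -addrA -opprD.
by rewrite -word_val_behead// -mulrBr normrM ger0_norm// ler_wpM2l.
Qed.

Let eps_ge0 : 0 <= eps. Proof. exact: normr_ge0. Qed.

Let eps_le_k : eps <= k%:R * eps.
Proof. by rewrite ler_peMl// ler1n; lia. Qed.

(** Pushing divides the error by [k], which is more than enough. *)
Let eval_push (s : symbol M) (i : 'I_4) (w : seq (symbol M)) :
  nth 0 (codes c) i = word_val R w ->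
  `|peval env (push s i) - word_val R (s :: w)| <= k%:R * eps.
Proof.
move=> cw; have := close i; rewrite cw => h.
rewrite -[peval env _]/(ratr (1 / k%:R) *
  (ratr (digit s)%:R + x 0 (input i))).
rewrite x_input word_val_cons rmorph_nat fmorph_div rmorph1 rmorph_nat.
rewrite mul1r mulrC -mulrBl opprD addrACA subrr add0r normrM normfV.
rewrite normr_nat ler_pdivrMr ?ltr0n; last by lia.
rewrite (le_trans h)// (le_trans eps_le_k)// ler_peMr ?mulr_ge0// ler1n; lia.
Qed.

Let eval_stay (i : 'I_4) : `|peval env (X i) - nth 0 (codes c) i| <= k%:R * eps.
Proof.
by rewrite -[peval env _]/(x 0 (input i)) x_input (le_trans (close i)).
Qed.

Let eval_exact (P : pexpr var) (a : nat) : peval env P = a%:R ->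
  `|peval env P - a%:R| <= k%:R * eps.
Proof. by move=> ->; rewrite subrr normr0 mulr_ge0. Qed.

Lemma step_expr_correct (i : 'I_4) :
  `|peval env (step_expr i) - encode R (next_config c) 0 i| <= k%:R * eps.
Proof.
have c0 : nth 0 (codes c) i0 = word_val R (tape_left c) by rewrite inordK.
have c2 : nth 0 (codes c) i2 = word_val R (tape_right c) by rewrite inordK.
have d0 : nth 0%N (digits c) i0 = first_digit (tape_left c) by rewrite inordK.
have d2 : nth 0%N (digits c) i2 = first_digit (tape_right c) by rewrite inordK.
have x0 := eval_stay i0; have x2 := eval_stay i2; rewrite c0 in x0; rewrite c2 in x2.
have cst a : peval env (PCst a%:R) = a%:R by rewrite /= rmorph_nat.
rewrite eval_step_expr mxE (tnth_nth 0).
(* Unfolds the step in terms of projections, since [c] occurs in the hypotheses and in [env] and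
   cannot be destructed in place. *)
have -> : next_config c =
    let: (q', s', mv) := delta (state c) (head_symbol c) in
    match mv with
    | MoveL => Config (behead (tape_left c)) (head (blank M) (tape_left c))
                 (s' :: tape_right c) q'
    | Stay => Config (tape_left c) s' (tape_right c) q'
    | MoveR => Config (s' :: tape_left c) (head (blank M) (tape_right c))
                 (behead (tape_right c)) q'
    end by case: (c).
rewrite /step [in (_, _).1]/= [in (_, _).2]/=.
(* Twelve goals: the moves left, stay and right, each with the four coordinates of the encoding. *)
case: (delta _ _) => [[q' s'] [||]]; case: i => [[|[|[|[|//]]]] p].
- exact: eval_pop.
- by apply: eval_exact; exact: eval_symbol_of.
- exact: eval_push.
- by apply: eval_exact; exact: cst.
- exact: x0.
- by apply: eval_exact; exact: cst.
- exact: x2.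
- by apply: eval_exact; exact: cst.
- exact: eval_push.
- by apply: eval_exact; exact: eval_symbol_of.
- exact: eval_pop.
- by apply: eval_exact; exact: cst.
Qed.

End RealStep.

Theorem theorem7 (R : realType) (K : {pred R}) (hK : generable_field K)
    (k : nat) (hk : (2 <= k)%N) (M : turing_machine k) :
  exists realstep : 'rV[R]_(4 + 1) -> 'rV[R]_4,
    AP K [set z : 'rV[R]_(4 + 1) | 0 <= (rsubmx z : 'rV[R]_1) 0 0] realstep /\
    (forall (c : config M) (mu : R) (cbar : 'rV[R]_4),
       0 <= mu ->
       `|encode R c - cbar| <= (2 * k%:R ^+ 2)^-1 - expR (- mu) ->
       `|realstep (row_mx cbar (mu%:M : 'rV[R]_1)) - encode R (next_config c)|
         <= k%:R * `|encode R c - cbar|).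
Proof.
exists (fun x => \row_i
  peval (threshold_env mu_index (@rounding_arg k M) x) (@step_expr k M i)).
split=> [|c mu cbar mu0 eps_le].
  (* The last block of the input is its coordinate [mu_index], the precision parameter of the
     threshold system. *)
  rewrite (_ : [set _ | _] = [set x : 'rV[R]_(4 + 1) | 0 <= x 0 mu_index]).
    by apply: AP_threshold; case: hK.
  by apply/funext => x /=; rewrite mxE.
apply: row_norm_le => [|i]; first by rewrite mulr_ge0.
by rewrite 2!mxE [in X in _ + X]mxE; exact: step_expr_correct.
Qed.
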